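(* Let $(M,\mathcal{O})$ be a split complex supermanifold with reduction $(M,\mathcal F)$, let $\mathcal{S}=\mathcal{S}_{\bar 0}\oplus\mathcal{S}_{\bar 1}$ be a $\mathbb{Z}_2$-graded locally free sheaf of $\mathcal{F}$-modules of finite rank on $M$, and let $\mathcal{E}_{\mathrm{gr}}=\mathcal{O}\otimes_{\mathcal{F}}\mathcal{S}$. Then there is a bijection $$\{[\mathcal{E}]_{\mathrm{id}}\mid \mathrm{gr}\,\mathcal{E}=\mathcal{E}_{\mathrm{gr}}\}\ \stackrel{1:1}{\longleftrightarrow}\ H^1(M,\mathcal{A}ut^{\mathcal{O}}_{(1)}\mathcal{E}_{\mathrm{gr}})/H^0(M,\mathcal{A}ut^{\mathcal{O}}_0\mathcal{E}_{\mathrm{gr}}),$$ where $\mathcal E$ runs over locally free sheaves of $\mathcal O$-modules on $(M,\mathcal O)$ and $[\mathcal E]_{\mathrm{id}}$ is the isomorphism class of $\mathcal E$ as a $\mathbb Z_2$-graded sheaf of $\mathcal O$-modules. Moreover, the unit $\epsilon\in H^1(M,\mathcal{A}ut^{\mathcal{O}}_{(1)}\mathcal{E}_{\mathrm{gr}})$ is a fixed point of the action of the group $H^0(M,\mathcal{A}ut^{\mathcal{O}}_0\mathcal{E}_{\mathrm{gr}})$.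
   Context: A complex supermanifold $(M,\mathcal O)$ of dimension $n|m$ is a $\mathbb Z_2$-graded ringed space locally isomorphic to a superdomain in $\mathbb C^{n|m}$. Let $\mathcal J\subset\mathcal O$ be the sheaf of ideals generated by $\mathcal O_{\bar 1}$; $\mathcal F=\mathcal O/\mathcal J$ is the structure sheaf of the underlying complex manifold. $(M,\mathcal O)$ is split if $\mathcal O=\bigwedge_{\mathcal F}\mathcal G$ for a locally free sheaf $\mathcal G$ of $\mathcal F$-modules; then $\mathcal O=\bigoplus_p\mathcal O_p$ with $\mathcal O_p=\bigwedge^p\mathcal G$ is $\mathbb Z$-graded and is identified with $\mathrm{gr}\,\mathcal O=\bigoplus_p\mathcal J^p/\mathcal J^{p+1}$. A $\mathbb Z_2$-graded sheaf of $\mathcal O$-modules is locally free of rank $p|q$ if it is locally isomorphic to $\mathcal O^p\oplus\Pi(\mathcal O)^q$ ($\Pi$ the parity change). For a locally free sheaf $\mathcal E$ of $\mathcal O$-modules put $\mathcal E_{(p)}=\mathcal J^p\mathcal E$ and $\mathcal E_{\mathrm{red}}=\mathcal E/\mathcal J\mathcal E$; the retract of $\mathcal E$ is the $\mathbb Z$-graded sheaf $\mathrm{gr}\,\mathcal E=\bigoplus_p\mathcal E_{(p)}/\mathcal E_{(p+1)}\simeq\mathrm{gr}\,\mathcal O\otimes_{\mathcal F}\mathcal E_{\mathrm{red}}$. The sheaf $\mathcal E_{\mathrm{gr}}=\mathcal O\otimes_{\mathcal F}\mathcal S$ has $\mathbb Z$-grading $(\mathcal E_{\mathrm{gr}})_p=\mathcal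 O_p\otimes\mathcal S$ and $\mathbb Z_2$-grading $(\mathcal E_{\mathrm{gr}})_{\bar 0}=\mathcal O_{\bar0}\otimes\mathcal S_{\bar0}+\mathcal O_{\bar1}\otimes\mathcal S_{\bar1}$, $(\mathcal E_{\mathrm{gr}})_{\bar 1}=\mathcal O_{\bar0}\otimes\mathcal S_{\bar1}+\mathcal O_{\bar1}\otimes\mathcal S_{\bar0}$. The condition $\mathrm{gr}\,\mathcal E=\mathcal E_{\mathrm{gr}}$ means that they coincide up to an isomorphism of $\mathcal O$-modules preserving the $\mathbb Z$- and $\mathbb Z_2$-gradings. All (iso)morphisms of sheaves of modules preserve the $\mathbb Z_2$-grading. $\mathcal Aut^{\mathcal O}\mathcal E_{\mathrm{gr}}$ is the sheaf of ($\mathcal O$-linear, parity preserving) automorphisms of $\mathcal E_{\mathrm{gr}}$; $\mathcal Aut^{\mathcal O}_{(1)}\mathcal E_{\mathrm{gr}}$ is the subsheaf of those $a$ with $a(v)\equiv v\bmod(\mathcal E_{\mathrm{gr}})_{(1)}$ for all $v$; $\mathcal Aut^{\mathcal O}_0\mathcal E_{\mathrm{gr}}$ is the subsheaf of those preserving the $\mathbb Z$-grading of $\mathcal E_{\mathrm{gr}}$. $H^1(M,\mathcal Q)$ for a sheaf of non-abelian groups $\mathcal Q$ is the usual (Čech) pointed cohomology set, with unit $\epsilon$ the class of the trivial cocycle. The group $H^0(M,\mathcal Aut^{\mathcal O}_0\mathcal E_{\mathrm{gr}})$ acts on $\mathcal Aut^{\mathcal O}_{(1)}\mathcal E_{\mathrm{gr}}$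 by conjugation $\delta\mapsto a\circ\delta\circ a^{-1}$, hence on its $H^1$; the quotient is the set of orbits. *)

(* Defs.v *)
From HB Require Import structures.
From mathcomp Require Import all_boot all_order all_algebra.
From mathcomp Require Import complex.
From mathcomp Require Import all_classical all_reals.
From mathcomp Require Import topology normedtype derive.

Set Implicit Arguments.
Unset Strict Implicit.
Unset Printing Implicit Defensive.

Import Order.TTheory GRing.Theory Num.Theory.
Import numFieldNormedType.Exports.

Local Open Scope classical_set_scope.
Local Open Scope ring_scope.
Local Open Scope complex_scope.

(** A sheaf on [M] is given by its étalé space: the family of stalks [A] and
    the predicate [sec x s] "the family of germs [s] is a continuous section of
    the étalé space on some neighbourhood of [x]".  Values of [s] far from [x]
    are irrelevant, so a section over an open set [U] is a total family [s]
    with [sec x s] for all [x] in [U], taken up to equality on [U].  The four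
    clauses say: [sec] is local; it is an open condition; there is a section
    through every germ; sections agreeing at a point agree near it. *)
Definition etale (M : topologicalType) (A : M -> Type)
    (sec : forall x, (forall y, A y) -> Prop) : Prop :=
  [/\ forall x s t, sec x s -> (\forall y \near x, s y = t y) -> sec x t,
      forall x s, sec x s -> \forall y \near x, sec y s,
      forall x (a : A x), exists2 s, sec x s & s x = a
    & forall x s t, sec x s -> sec x t -> s x = t x ->
        \forall y \near x, s y = t y].

Definition section_on (M : topologicalType) (A : M -> Type)
    (sec : forall x, (forall y, A y) -> Prop) (U : set M) (s : forall y, A y) :=
  forall x, U x -> sec x s.

(** [Z_2]-grading [A = A_0 (+) A_1] of a sheaf of abelian groups; [false] is
    even and [true] is odd.  The last clause says that [A_b] is a subsheaf,
    i.e. an open subset of the étalé space. *)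
Definition superspace (M : topologicalType) (A : M -> zmodType)
    (sec : forall x, (forall y, A y) -> Prop)
    (par : bool -> forall x, set (A x)) : Prop :=
  [/\ forall b x, par b x 0 /\
        (forall u v, par b x u -> par b x v -> par b x (u - v)),
      forall x u, exists2 v, par false x v & par true x (u - v),
      forall x u, par false x u -> par true x u -> u = 0
    & forall b x s, sec x s -> par b x (s x) ->
        \forall y \near x, par b y (s y)].

Record salg (R : realType) (M : topologicalType) := SAlg {
  alg :> M -> algType R[i];
  asec : forall x, (forall y, alg y) -> Prop;
  apar : bool -> forall x, set (alg x);
  alg_etale : @etale M alg asec;
  alg_super : @superspace M alg asec apar;
  alg_sec1 : forall x, asec x (fun=> 1);
  alg_secB : forall x s t, asec x s -> asec x t -> asec x (fun y => s y - t y);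
  alg_secM : forall x s t, asec x s -> asec x t -> asec x (fun y => s y * t y);
  alg_secZ : forall x (c : R[i]) s, asec x s -> asec x (fun y => c *: s y);
  alg_par1 : forall x, apar false (1 : alg x);
  alg_parM : forall b c x (u v : alg x), apar b u -> apar c v ->
    apar (b (+) c) (u * v)
}.

Record smod (R : realType) (M : topologicalType) (O : salg R M) := SMod {
  mod :> forall x, lmodType (O x);
  msec : forall x, (forall y, mod y) -> Prop;
  mpar : bool -> forall x, set (mod x);
  mod_etale : @etale M mod msec;
  mod_super : @superspace M mod msec mpar;
  mod_secB : forall x s t, msec x s -> msec x t -> msec x (fun y => s y - t y);
  mod_secZ : forall x a s, asec x a -> msec x s -> msec x (fun y => a y *: s y);
  mod_parZ : forall b c x (a : O x) (u : mod x), apar b a -> mpar c u ->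
    mpar (b (+) c) (a *: u)
}.

Definition salg_morphism (R : realType) (M : topologicalType) (A B : salg R M)
    (f : forall x, A x -> B x) : Prop :=
  [/\ forall x, f x 1 = 1,
      forall x c u v, f x (c *: u + v) = c *: f x u + f x v,
      forall x u v, f x (u * v) = f x u * f x v,
      forall b x (u : A x), apar b u -> apar b (f x u)
    & forall x s, asec x s -> asec x (fun y => f y (s y))].

(** Isomorphisms [E|U -> E'|U]; only the values over [U] matter.  Continuity of
    the inverse is automatic for a bijective morphism of étalé spaces. *)
Definition smod_iso_on (R : realType) (M : topologicalType) (O : salg R M)
    (U : set M) (E E' : smod O) (phi : forall x, E x -> E' x) : Prop :=
  [/\ forall x, U x -> forall (a : O x) u v,
        phi x (a *: u + v) = a *: phi x u + phi x v,
      forall x, U x -> bijective (phi x),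
      forall b x, U x -> forall u, mpar b u -> mpar b (phi x u)
    & forall x, U x -> forall s, msec x s -> msec x (fun y => phi y (s y))].

(** Collections of sheaves or of cochains are too large for the universe of
    [set], so they are plain predicates; [large_bij] is [set_bij] for these. *)
Definition large (T : Type) := T -> Prop.

Definition large_bij (T T' : Type) (P : large T) (P' : large T')
    (f : T -> T') : Prop :=
  [/\ forall x, P x -> P' (f x),
      forall x y, P x -> P y -> f x = f y -> x = y
    & forall y, P' y -> exists2 x, P x & f x = y].

Definition iso_class (R : realType) (M : topologicalType) (O : salg R M)
    (E : smod O) : large (smod O) :=
  fun E' => exists phi, @smod_iso_on R M O setT E E' phi.

Section FreeSheaf.
Variables (R : realType) (M : topologicalType) (O : salg R M) (p q : nat).

Definition free_stalk (x : M) : lmodType (O x) := 'rV[O x]_(p + q).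

Definition free_sec (x : M) (s : forall y, free_stalk y) : Prop :=
  forall j, asec x (fun y => (s y : 'rV[O y]_(p + q)) ord0 j).

(* The last [q] coordinates carry the opposite parity. *)
Definition free_par (b : bool) (x : M) : set (free_stalk x) :=
  [set v : 'rV[O x]_(p + q) |
     forall j : 'I_(p + q), apar (b (+) (p <= j)%N) (v ord0 j)].

Lemma free_etale : @etale M free_stalk free_sec.
Proof.
have [e1 e2 e3 e4] := alg_etale O.
split.
- move=> x s t hs hst j; apply: (e1 _ _ _ (hs j)).
  by apply: filterS hst => y ->.
- move=> x s hs; apply: filter_forall => j; exact: e2.
- move=> x a.
  have /choice[f hf] j : exists s, asec x s /\ s x = (a : 'rV[O x]_(p + q)) ord0 j.
    by have [s s1 s2] := e3 x ((a : 'rV[O x]_(p + q)) ord0 j); exists s.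
  exists (fun y => \row_j f j y).
    move=> j; apply: (e1 _ _ _ (hf j).1).
    by apply: nearW => y; rewrite mxE.
  by apply/rowP => j; rewrite mxE (hf j).2.
- move=> x s t hs ht hst.
  have : \forall y \near x, forall j,
      (s y : 'rV[O y]_(p + q)) ord0 j = (t y : 'rV[O y]_(p + q)) ord0 j.
    by apply: filter_forall => j; apply: e4; rewrite ?hst.
  by apply: filterS => y h; apply/rowP.
Qed.

Lemma free_super : @superspace M free_stalk free_sec free_par.
Proof.
have [g1 g2 g3 g4] := alg_super O.
split.
- move=> b x; split=> [j|u v hu hv j]; rewrite !mxE; first exact: (g1 _ x).1.
  exact: (g1 _ x).2.
- move=> x u; pose u' : 'rV[O x]_(p + q) := u.
  have h (j : 'I_(p + q)) : exists v : O x,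
      apar (p <= j)%N v /\ apar (~~ (p <= j)%N) (u' ord0 j - v).
    have [v v0 v1] := g2 x (u' ord0 j).
    case: (p <= j)%N; last by exists v.
    by exists (u' ord0 j - v); split; rewrite // subKr.
  have /choice[f hf] := h.
  by exists (\row_j f j) => j; rewrite !mxE; have [] := hf j.
- move=> x u h0 h1; apply/rowP => j; rewrite mxE.
  by move: (h0 j) (h1 j); case: (p <= j)%N => a b; apply: (g3 x).
- move=> b x s hs hp; apply: filter_forall => j.
  by apply: (g4 _ _ _ (hs j)); exact: (hp j).
Qed.

Lemma free_secB x s t : free_sec x s -> free_sec x t ->
  free_sec x (fun y => s y - t y).
Proof.
have [e1 _ _ _] := alg_etale O.
move=> hs ht j; apply: e1 (alg_secB (hs j) (ht j)) _.
by apply: nearW => y; rewrite !mxE.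
Qed.

Lemma free_secZ x a s : asec x a -> free_sec x s ->
  free_sec x (fun y => a y *: s y).
Proof.
have [e1 _ _ _] := alg_etale O.
move=> ha hs j; apply: e1 (alg_secM ha (hs j)) _.
by apply: nearW => y; rewrite !mxE.
Qed.

Lemma free_parZ b c x (a : O x) (u : free_stalk x) : apar b a -> free_par c u ->
  free_par (b (+) c) (a *: u).
Proof. by move=> ha hu j; rewrite mxE -addbA; exact: alg_parM. Qed.

Definition free_smod : smod O :=
  SMod free_etale free_super free_secB free_secZ free_parZ.

End FreeSheaf.

Definition locally_free (R : realType) (M : topologicalType) (O : salg R M)
    (E : smod O) : Prop :=
  forall x : M, exists p q (U : set M) phi,
    [/\ open U, U x & @smod_iso_on R M O U (free_smod O p q) E phi].

(* [xi_I xi_J = grassmann_sign I J * xi_(I :|: J)] for disjoint [I], [J]. *)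
Definition grassmann_sign (R : realType) (m : nat) (I J : {set 'I_m}) : R[i] :=
  (-1) ^+ #|[set k : 'I_m * 'I_m |
              [&& k.1 \in I, k.2 \in J & (k.2 < k.1)%N]]|.

(* [f : {set 'I_m} -> R[i]] stands for [\sum_I f I * xi_I]. *)
Definition grassmann_mul (R : realType) (m : nat) (f g : {set 'I_m} -> R[i])
    (K : {set 'I_m}) : R[i] :=
  \sum_(I : {set 'I_m} | I \subset K)
     grassmann_sign R I (K :\: I) * f I * g (K :\: I).

(* [k] is, in the coordinates [phi], a superfunction on [phi @` W], i.e. its
   coefficients are holomorphic (complex Fréchet differentiable). *)
Definition superholomorphic (R : realType) (M : topologicalType) (n m : nat)
    (phi : M -> 'rV[R[i]^o]_n) (W : set M) (k : M -> {set 'I_m} -> R[i]) :=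
  forall I, exists h : 'rV[R[i]^o]_n -> R[i]^o,
    (forall z, (phi @` W) z -> differentiable h z) /\
    (forall x, W x -> k x I = h (phi x)).

(** [(phi, theta)] is an isomorphism of [(V, O|V)] with a superdomain in
    [C^(n|m)]: [phi] is a homeomorphism of [V] onto an open set, and
    [s |-> theta s] is, over each open [W] in [V], an isomorphism of the
    superalgebra of sections of [O] with that of superfunctions on [phi @` W].
    It commutes with restriction because it is computed germwise:
    [theta x a I] is the value at [phi x] of the coefficient of [xi_I]. *)
Definition superchart (R : realType) (M : topologicalType) (n m : nat)
    (O : salg R M) (V : set M) (phi : M -> 'rV[R[i]^o]_n)
    (theta : forall x, O x -> {set 'I_m} -> R[i]) : Prop :=
  [/\ [/\ open V, {in V &, injective phi},
          (forall x, V x -> {for x, continuous phi})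
        & forall W, open W -> W `<=` V -> open (phi @` W)],
      [/\ forall x, V x -> forall I, theta x 1 I = (I == finset.set0)%:R,
          forall x, V x -> forall (c : R[i]) a b I,
            theta x (c *: a + b) I = c * theta x a I + theta x b I,
          forall x, V x -> forall a b I,
            theta x (a * b) I = grassmann_mul (theta x a) (theta x b) I
        & forall x, V x -> forall b a, apar b a ->
            forall I : {set 'I_m}, odd #|I| != b -> theta x a I = 0]
    & forall W, open W -> W `<=` V ->
      [/\ forall s, section_on (@asec _ _ O) W s ->
            superholomorphic phi W (fun x => theta x (s x)),
          forall s t, section_on (@asec _ _ O) W s ->
            section_on (@asec _ _ O) W t ->
            (forall x, W x -> theta x (s x) =1 theta x (t x)) ->
            forall x, W x -> s x = t x
        & forall k, superholomorphic phi W k ->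
            exists2 s, section_on (@asec _ _ O) W s &
              forall x, W x -> theta x (s x) =1 k x]].

Definition supermanifold (R : realType) (M : topologicalType) (n m : nat)
    (O : salg R M) : Prop :=
  forall x : M, exists V phi theta, V x /\ @superchart R M n m O V phi theta.

Definition sums (V : zmodType) (A : set V) : set V :=
  [set v | exists k (s : 'I_k -> V),
     (forall j, A (s j)) /\ v = \sum_(j < k) s j].

Definition odd_ideal (R : realType) (M : topologicalType) (O : salg R M)
    (x : M) : set (O x) :=
  sums [set u | exists a b c, apar true b /\ u = a * b * c].

(* [E_(p) = J^p E] *)
Fixpoint filtr (R : realType) (M : topologicalType) (O : salg R M)
    (E : smod O) (p : nat) (x : M) : set (E x) :=
  if p is p'.+1 then
    sums [set u | exists j v,
                    [/\ odd_ideal j, filtr p' v & u = j *: v]]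
  else setT.

(* [pr] exhibits [F] as the quotient [O / J]. *)
Definition reduction (R : realType) (M : topologicalType) (O F : salg R M)
    (pr : forall x, O x -> F x) : Prop :=
  [/\ salg_morphism pr, forall x f, exists a, pr x a = f
    & forall x a, pr x a = 0 <-> odd_ideal a].

Section Exterior.
Variables (R : realType) (M : topologicalType) (O F : salg R M) (G : smod F).
Variables (inc : forall x, F x -> O x) (io : forall x, G x -> O x).
Arguments inc {x}.
Arguments io {x}.

(** [inc] and [io] exhibit [O] as the exterior algebra of [G] over [F]; the
    universal property is that of the stalks [O_x = \bigwedge_(F_x) G_x].  [G]
    sits in odd degree, so that the [Z_2]-grading of [O] is the reduction of
    the grading by exterior degree. *)
Definition exterior_algebra : Prop :=
  [/\ salg_morphism (@inc),
      [/\ forall x (g : G x), mpar true g,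
          forall x (g : G x), apar true (io g)
        & forall x s, msec x s -> asec x (fun y => io (s y))],
      [/\ forall x (f : F x) (a : O x), inc f * a = a * inc f,
          forall x (f : F x) (g h : G x), io (f *: g + h) = inc f * io g + io h
        & forall x (g : G x), io g * io g = 0]
    & forall x (B : pzRingType) (j : F x -> B) (h : G x -> B),
        (forall f f', j (f + f') = j f + j f') ->
        (forall f f', j (f * f') = j f * j f') -> j 1 = 1 ->
        (forall f b, j f * b = b * j f) ->
        (forall f g g', h (f *: g + g') = j f * h g + h g') ->
        (forall g, h g * h g = 0) ->
        exists! Phi : O x -> B,
          [/\ (forall a a', Phi (a + a') = Phi a + Phi a'),
              (forall a a', Phi (a * a') = Phi a * Phi a'),
              Phi 1 = 1,
              (forall f, Phi (inc f) = j f)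
            & forall g, Phi (io g) = h g]].

(* [O_p = \bigwedge^p G] *)
Definition ext_deg (p : nat) (x : M) : set (O x) :=
  sums [set u | exists f (g : 'I_p -> G x),
                  u = inc f * \prod_(k < p) io (g k)].

Variables (S : smod F) (T : smod O) (ten : forall x, O x -> S x -> T x).
Arguments ten {x}.

(** [ten] exhibits [T] as the sheaf [O (x)_F S], with its [Z_2]-grading; the
    universal property is that of the stalks [O_x (x)_(F_x) S_x]. *)
Definition tensor_product : Prop :=
  [/\ [/\ forall x (a b : O x) (s : S x), ten (a + b) s = ten a s + ten b s,
          forall x (a : O x) (s t : S x), ten a (s + t) = ten a s + ten a t,
          forall x (a : O x) (f : F x) (s : S x), ten (a * inc f) s = ten a (f *: s)
        & forall x (a b : O x) (s : S x), ten (a * b) s = a *: ten b s],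
      forall b c x (a : O x) (s : S x), apar b a -> mpar c s ->
        mpar (b (+) c) (ten a s),
      forall x a s, asec x a -> msec x s -> msec x (fun y => ten (a y) (s y))
    & forall x (B : zmodType) (h : O x -> S x -> B),
        (forall a b s, h (a + b) s = h a s + h b s) ->
        (forall a s t, h a (s + t) = h a s + h a t) ->
        (forall a f s, h (a * inc f) s = h a (f *: s)) ->
        exists! Phi : T x -> B,
          (forall u v, Phi (u + v) = Phi u + Phi v) /\
          (forall a s, Phi (ten a s) = h a s)].

(* [T_p = O_p (x) S] *)
Definition ten_deg (p : nat) (x : M) : set (T x) :=
  sums [set u | exists a s, ext_deg p a /\ u = ten a s].

End Exterior.

Definition coset (V : zmodType) (B : set V) (v : V) : set V :=
  [set w | B (w - v)].

(* The stalk of [E_(p) / E_(p+1)], as a set of cosets. *)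
Definition gr_stalk (R : realType) (M : topologicalType) (O : salg R M)
    (E : smod O) (p : nat) (x : M) : set (set (E x)) :=
  [set coset (@filtr _ _ _ E p.+1 x) v | v in @filtr _ _ _ E p x].

(** [gr E = E'] for a sheaf [E'] with homogeneous components [deg p], over [O]
    with homogeneous components [odeg p].  An isomorphism preserving the
    [Z]-gradings is a family of isomorphisms [h p] of the components.  [O] acts
    on [gr E] through [O_q -> J^q / J^(q+1)], i.e. [a] in [O_q] sends the class
    of [v] in [E_(p)] to the class of [a *: v] in [E_(p+q)]. *)
Definition retract_is (R : realType) (M : topologicalType) (O : salg R M)
    (odeg : nat -> forall x, set (O x)) (E E' : smod O)
    (deg : nat -> forall x, set (E' x)) : Prop :=
  exists h : nat -> forall x, set (E x) -> E' x,
  let cl p x (v : E x) := h p x (coset (@filtr _ _ _ E p.+1 x) v) in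
  [/\ forall p x, set_bij (@gr_stalk _ _ _ E p x) (deg p x) (h p x),
      forall p x (u v : E x), filtr p u -> filtr p v ->
        cl p x (u + v) = cl p x u + cl p x v,
      forall p q x (a : O x) (v : E x), odeg q x a -> filtr p v ->
        a *: cl p x v = cl (p + q)%N x (a *: v),
      forall b p x (v : E x), filtr p v -> mpar b v -> mpar b (cl p x v)
    & forall p x s, msec x s -> (\forall y \near x, filtr p (s y)) ->
        msec x (fun y => cl p y (s y))].

Definition stalks (R : realType) (M : topologicalType) (O : salg R M)
    (E : smod O) (x : M) : choiceType := E x.

(** [Aut U phi] reads "[phi] is a section over [U]" of the sheaf of
    automorphisms (likewise below); only the values of [phi]
    over [U] matter. *)
Definition Aut (R : realType) (M : topologicalType) (O : salg R M)
    (E : smod O) (U : set M) (phi : forall x, E x -> E x) : Prop :=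
  smod_iso_on U phi.

Definition Aut1 (R : realType) (M : topologicalType) (O : salg R M)
    (E : smod O) (U : set M) (phi : forall x, E x -> E x) : Prop :=
  Aut U phi /\ forall x, U x -> forall v, filtr 1 (phi x v - v).

Definition Aut0 (R : realType) (M : topologicalType) (O : salg R M)
    (E : smod O) (deg : nat -> forall x, set (E x))
    (U : set M) (phi : forall x, E x -> E x) : Prop :=
  Aut U phi /\
  forall p x, U x -> forall v, deg p x v -> deg p x (phi x v).

Section Cech.
Variables (M : topologicalType) (E : M -> choiceType).
Variable Q : set M -> (forall x, E x -> E x) -> Prop.

Definition open_cover (I : Type) (U : I -> set M) : Prop :=
  (forall i, open (U i)) /\ forall x, exists i, U i x.

Record cochain := Cochain {
  idx : Type;
  cov : idx -> set M;
  val : idx -> idx -> forall x, E x -> E x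
}.

Definition cocycle (z : cochain) : Prop :=
  [/\ open_cover (@cov z),
      forall i j, Q (cov i `&` cov j) (@val z i j)
    & forall i j k x, (cov i `&` cov j `&` cov k) x ->
        forall v, @val z i j x (val j k v) = val i k v].

(* [z'_ij = c_i z_ij c_j^-1] on a common refinement of the two covers. *)
Definition cohomologous (z z' : cochain) : Prop :=
  exists (K : Type) (W : K -> set M) (t : K -> idx z) (t' : K -> idx z')
    (c : K -> forall x, E x -> E x),
  [/\ open_cover W,
      forall k, W k `<=` cov (t k) /\ W k `<=` cov (t' k),
      forall k, Q (W k) (c k)
    & forall k l x, (W k `&` W l) x -> forall v,
        @val z' (t' k) (t' l) x (c l x v) = c k x (val (t k) (t l) v)].

Definition cohomology_class (z : cochain) : large cochain :=
  fun z' => cocycle z' /\ cohomologous z z'.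

Definition H1 : large (large cochain) :=
  fun c => exists2 z, cocycle z & c = cohomology_class z.

Definition trivial_cochain : cochain :=
  @Cochain unit (fun=> setT) (fun _ _ x v => v).

Definition H1_unit : large cochain := cohomology_class trivial_cochain.

Definition fiber_inv (a : forall x, E x -> E x) (x : M) (v : E x) : E x :=
  xget v [set u | a x u = v].

Definition conj_cochain (a : forall x, E x -> E x) (z : cochain) : cochain :=
  @Cochain (idx z) (@cov z)
    (fun i j x v => a x (val i j (fiber_inv a v))).

Definition H1_act (a : forall x, E x -> E x) (c : large cochain) :
    large cochain :=
  fun z' => exists2 z, c z & cohomology_class (conj_cochain a z) z'.

(* The set of orbits in [H1] of the group of global sections of [P]. *)
Definition H1_orbits (P : set M -> (forall x, E x -> E x) -> Prop) :
    large (large (large cochain)) :=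
  fun o => exists2 c, H1 c & o = fun c' => exists2 a, P setT a & c' = H1_act a c.

End Cech.

(* Main.v *)
(** The universal property of the exterior algebra, applied to [g |-> g t] with
    values in [O_x[t]], yields the homogeneous components on the stalks of [O],
    hence on those of [Egr]; the odd ideal is the kernel of the component of
    degree 0, and it is nilpotent because products of more than [m] odd
    sections vanish in every superchart.  Given an identification of [gr E]
    with [Egr], a local basis of [E] is mapped to representatives of its
    symbols, which gives local isomorphisms [phi_i : E -> Egr] inducing that
    identification; each is bijective since it is so on the graded pieces of a
    finite filtration.  The cocycles [phi_i phi_j^-1] obtained from a fixed
    identification form exactly one class in [H^1(Aut_(1))], every cocycle
    arises by gluing copies of [Egr], and two identifications differ by a
    unique global section of [Aut_0], because [Egr = O (x) S] is generated in
    degree 0; that section acts on the class by conjugation. *)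

Require Import Defs.
From HB Require Import structures.
From mathcomp Require Import all_boot all_order all_algebra.
From mathcomp Require Import complex.
From mathcomp Require Import all_classical all_reals.
From mathcomp Require Import topology normedtype derive.

Set Implicit Arguments.
Unset Strict Implicit.
Unset Printing Implicit Defensive.

Import Order.TTheory GRing.Theory Num.Theory.
Local Open Scope classical_set_scope.
Local Open Scope ring_scope.

(** The exterior algebra and the tensor product are given by universal properties on stalks, so
    their elements have no normal form to compute with. The uniqueness clauses serve as induction
    principles, and continuity is recovered from sections through single germs. The charts enter
    through one fact, the vanishing of products of more than [m] odd germs; it makes every
    filtration stop at step [m.+1]. An isomorphism class of sheaves comes without a preferred
    identification of its retract. The map therefore sends it to the set of classes obtained from
    all identifications: it is then well defined at once, and what has to be proved is that this set
    is an orbit. *)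

(** * Subrings and subgroups cut out by a proposition, as targets for universal properties *)

Section Subrings.
Variables (B : pzRingType) (P : B -> Prop).

Definition is_subring :=
  [/\ P 1, forall u v, P u -> P v -> P (u - v) &
      forall u v, P u -> P v -> P (u * v)].

(** The closure proof is carried as an index, so that canonical structures can use it for a
    predicate that arises in the middle of an argument. *)
Definition subring_pred of is_subring : {pred B} := fun b => `[< P b >].

Record subring_of (hP : is_subring) :=
  SubringOf { subring_val : B; subring_valP : subring_val \in subring_pred hP }.

Variable hP : is_subring.

Fact subring_pred_closed : subring_closed (subring_pred hP).
Proof.
case: hP => h1 hB hM; split; first exact/asboolP.
  by move=> u v /asboolP hu /asboolP hv; apply/asboolP; apply: hB.
by move=> u v /asboolP hu /asboolP hv; apply/asboolP; apply: hM.
Qed.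

HB.instance Definition _ := [isSub for @subring_val hP].
HB.instance Definition _ := [Choice of subring_of hP by <:].
HB.instance Definition _ :=
  GRing.SubChoice_isSubPzRing.Build B _ (subring_of hP) subring_pred_closed.

End Subrings.

Section Subgroups.
Variables (V : zmodType) (P : V -> Prop).

Definition is_subgroup := P 0 /\ forall u v, P u -> P v -> P (u - v).

Definition subgroup_pred of is_subgroup : {pred V} := fun v => `[< P v >].

Record subgroup_of (hP : is_subgroup) := SubgroupOf {
  subgroup_val : V; subgroup_valP : subgroup_val \in subgroup_pred hP }.

Variable hP : is_subgroup.

Fact subgroup_pred_closed : zmod_closed (subgroup_pred hP).
Proof.
case: hP => h0 hB; split; first exact/asboolP.
by move=> u v /asboolP hu /asboolP hv; apply/asboolP; apply: hB.
Qed.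

HB.instance Definition _ := [isSub for @subgroup_val hP].
HB.instance Definition _ := [Choice of subgroup_of hP by <:].
HB.instance Definition _ :=
  GRing.SubChoice_isSubZmodule.Build V _ (subgroup_of hP) subgroup_pred_closed.

End Subgroups.

(** * Etale spaces and parity *)

Section Sums.
Variable V : zmodType.
Implicit Types (A : set V) (P : V -> Prop) (u v : V).

Lemma sums_ind A P : P 0 -> (forall u v, A u -> P v -> P (u + v)) ->
  forall v, sums A v -> P v.
Proof.
move=> P0 PD v [k [s [hs ->]]].
elim: k s hs => [|k IH] s hs; first by rewrite big_ord0.
by rewrite big_ord_recl; apply: PD => //; apply: IH.
Qed.

Lemma sums0 A : sums A 0.
Proof. by exists 0%N, (fun=> 0); split=> [[]//|]; rewrite big_ord0. Qed.

Lemma sums1 A u : A u -> sums A u.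
Proof. by move=> hu; exists 1%N, (fun=> u); rewrite big_ord1. Qed.

Lemma sumsD A u v : sums A u -> sums A v -> sums A (u + v).
Proof.
move=> hu hv; move: u hu; apply: sums_ind => [|u w hu IH]; first by rewrite add0r.
rewrite -addrA; case: IH => k [s [hs ->]].
exists k.+1, (fun j => if unlift ord0 j is Some i then s i else u).
split; last by rewrite big_ord_recl unlift_none; congr (_ + _);
  apply: eq_bigr => i _; rewrite liftK.
by move=> j; case: unliftP.
Qed.

Lemma sumsN A : (forall u, A u -> A (- u)) -> forall v, sums A v -> sums A (- v).
Proof.
move=> hA; apply: sums_ind => [|u v hu hv]; first by rewrite oppr0; exact: sums0.
by rewrite opprD; apply: sumsD => //; apply/sums1/hA.
Qed.

Lemma sumsS A (B : set V) : (forall u, A u -> sums B u) ->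
  forall v, sums A v -> sums B v.
Proof.
move=> hA; apply: sums_ind => [|u v hu hv]; first exact: sums0.
by apply: sumsD => //; apply: hA.
Qed.

Lemma sums_sum A (I : Type) (r : seq I) (Q : pred I) (s : I -> V) :
  (forall i, Q i -> sums A (s i)) -> sums A (\sum_(i <- r | Q i) s i).
Proof.
by move=> hs; apply: big_ind => //; [exact: sums0 | move=> *; exact: sumsD].
Qed.

End Sums.

Section Etale.
Variables (M : topologicalType) (A : M -> zmodType).
Variables (sec : forall x : M, (forall y, A y) -> Prop).
Hypothesis eA : @etale M A sec.

Lemma etale_eq x s t : sec x s -> (forall y, s y = t y) -> sec x t.
Proof. by case: eA => h _ _ _ hs hst; apply: h hs _; exact: nearW. Qed.

Lemma etale_near x s t : sec x s -> (\forall y \near x, s y = t y) -> sec x t.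
Proof. by case: eA => h _ _ _; exact: h. Qed.

Lemma etale_open x s : sec x s -> \forall y \near x, sec y s.
Proof. by case: eA => _ h _ _; exact: h. Qed.

Lemma etale_through x (a : A x) : exists2 s, sec x s & s x = a.
Proof. by case: eA => _ _ h _; exact: h. Qed.

Lemma etale_agree x s t : sec x s -> sec x t -> s x = t x ->
  \forall y \near x, s y = t y.
Proof. by case: eA => _ _ _ h; exact: h. Qed.

(** Sections through the same germ agree nearby, so continuity has to be tested on one section per
    germ only. Such sections can be found by induction on generators of the stalk. *)
Lemma etale_map (B : M -> Type) (secB : forall x, (forall y, B y) -> Prop)
    (f : forall x, A x -> B x) :
  @etale M B secB ->
  (forall x a, exists2 s, sec x s /\ s x = a & secB x (fun y => f y (s y))) ->
  forall x s, sec x s -> secB x (fun y => f y (s y)).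
Proof.
case=> hB _ _ _ hf x s hs; have [t [ht hts] hft] := hf x (s x).
apply: hB hft _; apply: filterS (etale_agree ht hs hts) => y -> //.
Qed.

Hypothesis secB : forall x s t, sec x s -> sec x t -> sec x (fun y => s y - t y).

Lemma sec0 x : sec x (fun=> 0).
Proof.
have [s hs _] := etale_through (0 : A x).
by apply: etale_eq (secB hs hs) _ => y; rewrite subrr.
Qed.

Lemma secD x s t : sec x s -> sec x t -> sec x (fun y => s y + t y).
Proof.
move=> hs ht; apply: etale_eq (secB hs (secB (sec0 x) ht)) _ => y.
by rewrite sub0r opprK.
Qed.

Lemma sec_sum x (I : Type) (r : seq I) (P : pred I) (s : I -> forall y, A y) :
  (forall i, P i -> sec x (s i)) -> sec x (fun y => \sum_(i <- r | P i) s i y).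
Proof.
move=> hs; elim: r => [|i r IH].
  by apply: etale_eq (sec0 x) _ => y; rewrite big_nil.
case Pi: (P i); last by apply: etale_eq IH _ => y; rewrite big_cons Pi.
by apply: etale_eq (secD (hs i Pi) IH) _ => y; rewrite big_cons Pi.
Qed.

Variable par : bool -> forall x : M, set (A x).
Hypothesis sA : superspace sec par.

Lemma par0 b x : par b (0 : A x).
Proof. by case: sA => h _ _ _; case: (h b x). Qed.

Lemma parB b x (u v : A x) : par b u -> par b v -> par b (u - v).
Proof. by case: sA => h _ _ _; case: (h b x) => _; exact. Qed.

Lemma parN b x (u : A x) : par b u -> par b (- u).
Proof. by rewrite -sub0r; apply: parB; exact: par0. Qed.

Lemma parD b x (u v : A x) : par b u -> par b v -> par b (u + v).
Proof. by move=> hu hv; rewrite -[v]opprK; apply/parB/parN. Qed.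

Lemma par_sum b x (I : Type) (r : seq I) (P : pred I) (s : I -> A x) :
  (forall i, P i -> par b (s i)) -> par b (\sum_(i <- r | P i) s i).
Proof.
by move=> hs; apply: big_ind => //; [exact: par0 | move=> *; exact: parD].
Qed.

Lemma par_uniq b x (u : A x) : par b u -> par (~~ b) u -> u = 0.
Proof. by case: sA => _ _ h _; case: b => h1 h2; apply: h. Qed.

Lemma par_split b x (u : A x) : exists v w, [/\ par b v, par (~~ b) w & u = v + w].
Proof.
case: sA => _ h _ _; have [v h0 h1] := h x u.
by case: b; [exists (u - v), v | exists v, (u - v)]; split; rewrite // ?subrK // addrC subrK.
Qed.

End Etale.

(** * Isomorphisms of sheaves of modules *)

Section Isomorphisms.
Variables (R : realType) (M : topologicalType) (O : salg R M).
Implicit Types (E : smod O) (U V : set M).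

(** [bijective] offers an inverse at each point of [U] only; [xget] makes it a total family, with
    value [0] where there is no preimage. *)
Definition iso_inv E E' (phi : forall x, E x -> E' x) (x : M) (w : E' x) : E x :=
  xget 0 [set u | phi x u = w].

Section OneMap.
Variables (E E' : smod O) (U : set M) (phi : forall x, E x -> E' x).
Hypothesis hphi : smod_iso_on U phi.

Lemma iso_lin x : U x -> forall (a : O x) u v,
  phi (a *: u + v) = a *: phi u + phi v.
Proof. by case: hphi => h _ _ _; exact: h. Qed.

Lemma isoD x u v : U x -> phi (u + v : E x) = phi u + phi v.
Proof. by move=> /iso_lin h; have := h 1 u v; rewrite !scale1r. Qed.

Lemma iso0 x : U x -> phi (0 : E x) = 0.
Proof. by move=> Ux; apply: (addrI (phi 0)); rewrite -isoD // !addr0. Qed.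

Lemma isoB x u v : U x -> phi (u - v : E x) = phi u - phi v.
Proof. by move=> Ux; apply/eqP; rewrite eq_sym subr_eq -isoD // subrK. Qed.

Lemma isoZ x (a : O x) u : U x -> phi (a *: u : E x) = a *: phi u.
Proof. by move=> Ux; have := iso_lin Ux a u 0; rewrite iso0 // !addr0. Qed.

Lemma iso_sec x s : U x -> msec x s -> msec x (fun y => phi (s y)).
Proof. by case: hphi => _ _ _ h Ux; exact: h. Qed.

Lemma iso_par b x (u : E x) : U x -> mpar b u -> mpar b (phi u).
Proof. by case: hphi => _ _ h _ Ux; exact: h. Qed.

Lemma iso_bij x : U x -> bijective (@phi x).
Proof. by case: hphi => _ h _ _; exact: h. Qed.

Lemma iso_inj x : U x -> injective (@phi x).
Proof. by move=> /iso_bij /bij_inj. Qed.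

(** Split [u] by parity: the image of the component of the wrong parity has both parities, hence
    vanishes, and injectivity kills the component itself. *)
Lemma iso_par_reflect b x (u : E x) : U x -> mpar b (phi u) -> mpar b u.
Proof.
move=> Ux; have [v [w [hv hw ->]]] := par_split (mod_super E) b u.
rewrite isoD // => h; suff -> : w = 0 by rewrite addr0.
apply: (iso_inj Ux); rewrite iso0 //.
apply: (par_uniq (mod_super E') (b := b)); last exact: iso_par.
rewrite -(addKr (phi v) (phi w)) addrC.
by apply: (parB (mod_super E')) => //; exact: iso_par.
Qed.

Lemma Kiso_inv x (w : E' x) : U x -> phi (iso_inv phi w) = w.
Proof.
move=> Ux; have [g _ gK] := iso_bij Ux.
rewrite /iso_inv; case: xgetP => [u _ //|/(_ (g w))]; case; exact: gK.
Qed.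

Lemma iso_invK x (u : E x) : U x -> iso_inv phi (phi u) = u.
Proof. by move=> Ux; apply: (iso_inj Ux); exact: Kiso_inv. Qed.

Lemma iso_sub (V : set M) : V `<=` U -> smod_iso_on V phi.
Proof. by case: hphi => h1 h2 h3 h4 VU; split=> [x /VU|x /VU|b x /VU|x /VU]; auto. Qed.

Lemma iso_filtr p x (u : E x) : U x -> filtr p u -> filtr p (phi u).
Proof.
elim: p u => [//|p IH] u Ux h.
elim/sums_ind: u / h => [|u v [j [w [hj hw ->]]] hv].
  by rewrite iso0 //; exact: sums0.
rewrite isoD // isoZ //; apply: sumsD => //; apply: sums1.
by exists j, (phi w); split=> //; exact: IH.
Qed.

Lemma iso_filtr_reflect p x (u : E x) : U x -> filtr p (phi u) -> filtr p u.
Proof.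
elim: p u => [//|p IH] u Ux h; rewrite -(iso_invK u Ux).
elim/sums_ind: (phi u) / h => [|v w [j [v' [hj hv' ->]]] hw].
  by rewrite -(iso0 Ux) iso_invK //; exact: sums0.
have -> : iso_inv phi (j *: v' + w) = j *: iso_inv phi v' + iso_inv phi w.
  by apply: (iso_inj Ux); rewrite iso_lin // !Kiso_inv.
apply: sumsD => //; apply: sums1; exists j, (iso_inv phi v'); split=> //.
by apply: IH => //; rewrite Kiso_inv.
Qed.

Lemma iso_inv_iso : open U -> smod_iso_on U (iso_inv phi).
Proof.
move=> oU; split=> [x Ux a u v|x Ux|b x Ux u hu|x Ux s hs].
- by apply: (iso_inj Ux); rewrite iso_lin // !Kiso_inv.
- by exists (@phi x) => u; rewrite ?Kiso_inv ?iso_invK.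
- by apply: iso_par_reflect => //; rewrite Kiso_inv.
(* Continuity of the inverse: the image of the section [t] through the preimage of [s x] agrees with
   [s] near [x], and there [t] is the preimage of [s]. *)
- have [t ht tx] := etale_through (mod_etale E) (iso_inv phi (s x)).
  have e : phi (t x) = s x by rewrite tx Kiso_inv.
  apply: (etale_near (mod_etale E) ht).
  have hn := etale_agree (mod_etale E') (iso_sec Ux ht) hs e.
  have : nbhs x U by exact: open_nbhs_nbhs.
  by apply: filterS2 hn => y <- Uy; rewrite iso_invK.
Qed.

End OneMap.

Lemma iso_id E U : @smod_iso_on R M O U E E (fun=> id).
Proof. by split=> // x _; exists id. Qed.

Lemma iso_comp E E' E'' U (phi : forall x, E x -> E' x)
    (psi : forall x, E' x -> E'' x) :
  smod_iso_on U phi -> smod_iso_on U psi ->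
  smod_iso_on U (fun x u => psi x (phi x u)).
Proof.
case=> h1 h2 h3 h4 [k1 k2 k3 k4].
split=> [x Ux a u v|x Ux|b x Ux u hu|x Ux s hs]; last exact: (k4 x Ux _ (h4 x Ux s hs)).
- by rewrite h1 // k1.
- exact: bij_comp (k2 x Ux) (h2 x Ux).
- exact/k3/h3.
Qed.

(** Global maps will use at each point a chart chosen for that point; near [x] they coincide with a
    single isomorphism [psi], and this suffices. *)
Lemma iso_local E E' U (phi : forall x, E x -> E' x) :
  (forall x, U x -> exists V psi, [/\ open V, V x, @smod_iso_on R M O V E E' psi
     & forall y, V y -> forall u, phi y u = psi y u]) ->
  smod_iso_on U phi.
Proof.
move=> h; split=> [x Ux a u v|x Ux|b x Ux u hu|x Ux s hs];
    have [V [psi [oV Vx [h1 h2 h3 h4] e]]] := h x Ux.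
- by rewrite !e // h1.
- by apply: (eq_bij (h2 x Vx)) => u; rewrite e.
- by rewrite e //; exact: h3.
- apply: (etale_near (mod_etale E') (h4 x Vx s hs)).
  have : nbhs x V by exact: open_nbhs_nbhs.
  by apply: filterS => y Vy; rewrite e.
Qed.

Section FreeBasis.
Variables (p q : nat).
Implicit Types (j : 'I_(p + q)).

Definition basis_vec j y : free_smod O p q y := delta_mx ord0 j : 'rV[O y]_(p + q).

Lemma basis_vec_par j y : mpar (p <= j)%N (basis_vec j y).
Proof.
move=> i; rewrite mxE eqxx /=; case: eqP => [->|_]; last exact: (par0 (alg_super O)).
by rewrite addbb; exact: alg_par1.
Qed.

Lemma basis_vec_sec j y : msec y (basis_vec j).
Proof.
move=> i; case: (eqVneq i j) => [->|/negPf ij].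
  by apply: (etale_eq (alg_etale O) (alg_sec1 O y)) => t; rewrite mxE !eqxx.
apply: (etale_eq (alg_etale O) (sec0 (alg_etale O) (@alg_secB _ _ O) y)) => t.
by rewrite mxE ij andbF.
Qed.

Variables (E : smod O) (U : set M) (chi : forall x, free_smod O p q x -> E x).
Hypothesis hchi : smod_iso_on U chi.

Lemma free_iso_sum y (v : 'rV[O y]_(p + q)) : U y ->
  chi (v : free_smod O p q y) = \sum_j v ord0 j *: chi (basis_vec j y).
Proof.
move=> Uy; rewrite [v in LHS]row_sum_delta.
rewrite (big_morph (@chi y) (id1 := 0) (op1 := +%R)) => [|u w|].
- by apply: eq_bigr => j _; rewrite (isoZ hchi).
- exact: (isoD hchi).
- exact: (iso0 hchi).
Qed.

End FreeBasis.

End Isomorphisms.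

(** * The grading of an exterior algebra *)

Section Retract.
Variables (R : realType) (M : topologicalType) (n m : nat) (O : salg R M).
Hypothesis hO : supermanifold n m O.
Variables (F : salg R M) (pr : forall x : M, O x -> F x).
Hypothesis hF : reduction pr.
Variables (G : smod F) (inc : forall x : M, F x -> O x).
Variable io : forall x : M, G x -> O x.
Hypothesis hsplit : exterior_algebra inc io.
Hypothesis hinc : forall (x : M) (f : F x), pr (inc f) = f.
Local Arguments inc {x}.
Local Arguments io {x}.
Local Notation odeg := (ext_deg (@inc) (@io)).

Lemma incD x (f g : F x) : inc (f + g) = inc f + inc g.
Proof. by have [[_ h _ _ _] _ _ _] := hsplit; rewrite -[f]scale1r h !scale1r. Qed.

Lemma inc0 x : inc (0 : F x) = 0.
Proof. by apply: (addrI (inc 0)); rewrite -incD !addr0. Qed.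

Lemma inc1 x : inc (1 : F x) = 1.
Proof. by have [[h _ _ _ _] _ _ _] := hsplit; exact: h. Qed.

Lemma incM x (f g : F x) : inc (f * g) = inc f * inc g.
Proof. by have [[_ _ h _ _] _ _ _] := hsplit; exact: h. Qed.

Lemma incC x (f : F x) (a : O x) : inc f * a = a * inc f.
Proof. by have [_ _ [h _ _] _] := hsplit; exact: h. Qed.

Lemma inc_sec x s : asec x s -> asec x (fun y => inc (s y)).
Proof. by have [[_ _ _ _ h] _ _ _] := hsplit; exact: h. Qed.

Lemma io_lin x (f : F x) (g h : G x) : io (f *: g + h) = inc f * io g + io h.
Proof. by have [_ _ [_ h1 _] _] := hsplit; exact: h1. Qed.

Lemma io_sq x (g : G x) : io g * io g = 0.
Proof. by have [_ _ [_ _ h] _] := hsplit; exact: h. Qed.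

Lemma io_odd x (g : G x) : apar true (io g).
Proof. by have [_ [_ h _] _ _] := hsplit; exact: h. Qed.

Lemma io_sec x s : msec x s -> asec x (fun y => io (s y)).
Proof. by have [_ [_ _ h] _ _] := hsplit; exact: h. Qed.

(* The factorisation of the identity through the subring cut out by [P] is
   unique, hence that subring is everything. *)
Lemma ext_ind x (P : O x -> Prop) : is_subring P ->
  (forall f, P (inc f)) -> (forall g, P (io g)) -> forall a, P a.
Proof.
move=> hP Pinc Pio a; have [_ _ _ univ] := hsplit.
have inP b : P b -> b \in subring_pred hP by move=> hb; apply/asboolP.
have [Phi [[h1 h2 h3 h4 h5] _]] : exists! Phi : O x -> subring_of hP,
    [/\ (forall a a', Phi (a + a') = Phi a + Phi a'),
        (forall a a', Phi (a * a') = Phi a * Phi a'), Phi 1 = 1,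
        (forall f, Phi (inc f) = SubringOf (inP _ (Pinc f)))
      & forall g, Phi (io g) = SubringOf (inP _ (Pio g))].
  apply: univ => [f g|f g||f b|f g h|g]; apply: val_inj.
  - by rewrite rmorphD /= incD.
  - by rewrite rmorphM /= incM.
  - by rewrite rmorph1 /= inc1.
  - by rewrite !rmorphM /= incC.
  - by rewrite rmorphD rmorphM /= io_lin.
  - by rewrite rmorphM rmorph0 /= io_sq.
have [Psi [_ hU]] := univ x (O x) (@inc x) (@io x) (@incD x) (@incM x) (inc1 x)
  (@incC x) (@io_lin x) (@io_sq x).
have e1 : Psi = val \o Phi.
  apply: hU; split=> [b b'|b b'||f|g] /=; rewrite ?h1 ?h2 ?h3 ?h4 ?h5 //.
have e2 : Psi = id by apply: hU.
have -> : a = val (Phi a) by rewrite -[val _]/((val \o Phi) a) -e1 e2.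
by have /asboolP := subring_valP (Phi a).
Qed.

Lemma gr_exists x : exists gr : O x -> {poly O x},
  [/\ forall a b, gr (a + b) = gr a + gr b,
      forall a b, gr (a * b) = gr a * gr b, gr 1 = 1,
      forall f, gr (inc f) = (inc f)%:P & forall g, gr (io g) = (io g)%:P * 'X].
Proof.
have [_ _ _ univ] := hsplit.
have [||||||gr [h _]] := univ x {poly O x} (fun f => (inc f)%:P)
  (fun g => (io g)%:P * 'X); last by exists gr.
- by move=> f g; rewrite incD polyCD.
- by move=> f g; rewrite incM polyCM.
- by rewrite inc1.
- by move=> f b; apply/polyP => i; rewrite coefCM coefMC incC.
- by move=> f g h; rewrite io_lin polyCD mulrDl polyCM -mulrA.
(* ['X] commutes with all coefficients, although these need not commute with each other, so the two
   copies of [io g] can be brought together. *)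
- move=> g; rewrite -mulrA [X in _ * X]mulrA -commr_polyX -!mulrA mulrA.
  by rewrite -polyCM io_sq mul0r.
Qed.

(* [gr a] is the polynomial [\sum_p a_p t^p] of the homogeneous components. *)
Definition gr x : O x -> {poly O x} := projT1 (cid (gr_exists x)).
Definition gr_spec x := projT2 (cid (gr_exists x)).
Definition comp (p : nat) x (a : O x) : O x := (gr a)`_p.

Lemma grD x (a b : O x) : gr (a + b) = gr a + gr b.
Proof. by have [h _ _ _ _] := gr_spec x; exact: h. Qed.

Lemma grM x (a b : O x) : gr (a * b) = gr a * gr b.
Proof. by have [_ h _ _ _] := gr_spec x; exact: h. Qed.

Lemma gr_inc x (f : F x) : gr (inc f) = (inc f)%:P.
Proof. by have [_ _ _ h _] := gr_spec x; exact: h. Qed.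

Lemma gr_io x (g : G x) : gr (io g) = (io g)%:P * 'X.
Proof. by have [_ _ _ _ h] := gr_spec x; exact: h. Qed.

Lemma gr1 x : gr (1 : O x) = 1.
Proof. by rewrite -inc1 gr_inc inc1. Qed.

Lemma gr0 x : gr (0 : O x) = 0.
Proof. by rewrite -inc0 gr_inc inc0. Qed.

Lemma grB x (a b : O x) : gr (a - b) = gr a - gr b.
Proof. by apply/eqP; rewrite eq_sym subr_eq -grD subrK. Qed.

Lemma compD p x (a b : O x) : comp p (a + b) = comp p a + comp p b.
Proof. by rewrite /comp grD coefD. Qed.

Lemma compB p x (a b : O x) : comp p (a - b) = comp p a - comp p b.
Proof. by rewrite /comp grB coefB. Qed.

Lemma comp0 p x : comp p (0 : O x) = 0.
Proof. by rewrite /comp gr0 coef0. Qed.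

Lemma compM p x (a b : O x) :
  comp p (a * b) = \sum_(i < p.+1) comp i a * comp (p - i) b.
Proof. by rewrite /comp grM coefM. Qed.

Lemma comp_mulinc p x (a : O x) (f : F x) : comp p (a * inc f) = comp p a * inc f.
Proof. by rewrite /comp grM gr_inc coefMC. Qed.

(** The sum of the components is the value of [gr a] at 1. Evaluation at 1 is multiplicative even
    over a noncommutative ring, so the equality passes from generators to all of [O x]. *)
Lemma comp_total x (a : O x) : a = \sum_(p < size (gr a)) comp p a.
Proof.
have -> : \sum_(p < size (gr a)) comp p a = (gr a).[1].
  by rewrite horner_coef; apply: eq_bigr => i _; rewrite expr1n mulr1.
elim/ext_ind: a => [|f|g]; first 1 last.
- by rewrite gr_inc hornerC.
- by rewrite gr_io hornerMX hornerC mulr1.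
split=> [|a b ha hb|a b ha hb].
- by rewrite gr1 hornerC.
- by rewrite grB hornerD hornerN -ha -hb.
- by rewrite grM hornerM_comm -?ha -?hb // /comm_poly mulr1 mul1r.
Qed.

Lemma ext_degM p q x (a b : O x) :
  odeg p a -> odeg q b -> odeg (p + q) (a * b).
Proof.
move=> ha hb; move: a ha; apply: sums_ind => [|a a' [f [g ->]] ha'].
  by rewrite mul0r; exact: sums0.
rewrite mulrDl; apply: sumsD => //; move: b hb {ha'}; apply: sums_ind.
  by rewrite mulr0; exact: sums0.
move=> b b' [f' [g' ->]] hb'; rewrite mulrDr; apply: sumsD => //; apply: sums1.
exists (f * f'), (fun k => match fintype.split k with inl i => g i | inr i => g' i end).
rewrite big_split_ord /= incM -!mulrA; congr (_ * _).
rewrite mulrA -incC -mulrA; congr (_ * (_ * _)); apply: eq_bigr => i _.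
  by rewrite -[lshift _ _]/(unsplit (inl i)) unsplitK.
by rewrite -[rshift _ _]/(unsplit (inr i)) unsplitK.
Qed.

Lemma ext_deg_inc x (f : F x) : odeg 0 (inc f).
Proof.
apply: sums1; exists f, (fun i => 0).
by rewrite big_ord0 mulr1.
Qed.

Lemma ext_deg_io x (g : G x) : odeg 1 (io g).
Proof.
by apply: sums1; exists 1, (fun=> g); rewrite inc1 mul1r big_ord1.
Qed.

Lemma ext_degN p x (a : O x) : odeg p a -> odeg p (- a).
Proof.
apply: sumsN => b [f [g ->]]; exists (- f), g.
suff -> : inc (- f) = - inc f by rewrite mulNr.
by apply: (addrI (inc f)); rewrite -incD !subrr inc0.
Qed.

Lemma ext_degB p x (a b : O x) : odeg p a -> odeg p b -> odeg p (a - b).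
Proof. by move=> ha hb; apply/sumsD/ext_degN. Qed.

Lemma ext_deg0E x (a : O x) : odeg 0 a -> exists f, a = inc f.
Proof.
move=> h; elim/sums_ind: a / h => [|b c [f [g ->]] [f' ->]]; first by exists 0; rewrite inc0.
by exists (f + f'); rewrite big_ord0 mulr1 incD.
Qed.

Lemma gr_deg p x (a : O x) : odeg p a -> gr a = a%:P * 'X^p.
Proof.
move=> h; elim/sums_ind: a / h => [|b c [f [g ->]] hc]; first by rewrite gr0 mul0r.
rewrite grD polyCD mulrDl hc {hc}; congr (_ + _).
rewrite grM gr_inc polyCM -mulrA; congr (_ * _).
elim: p g => [|p IH] g; first by rewrite !big_ord0 gr1 mulr1.
rewrite !big_ord_recl grM gr_io IH polyCM exprS -!mulrA; congr (_ * _).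
by rewrite !mulrA commr_polyX.
Qed.

Lemma comp_deg p q x (a : O x) : odeg p a -> comp q a = if q == p then a else 0.
Proof.
move=> /gr_deg; rewrite /comp => ->; rewrite coefMXn coefC subn_eq0.
by case: ltngtP.
Qed.

(** By induction on generators, with [p] general, because the component of a product involves
    components of the factors in all degrees up to [p]. *)
Lemma compP p x (a : O x) : odeg p (comp p a).
Proof.
elim/ext_ind: a p => [|f p|g p]; first 1 last.
- rewrite (comp_deg _ (ext_deg_inc f)); case: eqP => [->|_]; last exact: sums0.
  exact: ext_deg_inc.
- rewrite (comp_deg _ (ext_deg_io g)); case: eqP => [->|_]; last exact: sums0.
  exact: ext_deg_io.
split=> [p|a b ha hb p|a b ha hb p].
- rewrite -(inc1 x) (comp_deg _ (ext_deg_inc 1)).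
  by case: eqP => [->|_]; [exact: ext_deg_inc | exact: sums0].
- by rewrite compB; exact: ext_degB.
- rewrite compM; apply: sums_sum => i _.
  have e : (i + (p - i))%N = p by rewrite subnKC // -ltnS.
  by have := ext_degM (ha i) (hb (p - i)%N); rewrite e.
Qed.

(** By [etale_map] one good section through each germ suffices. [inc] and [io] turn sections of [F]
    and [G] into sections of constant degree, and differences and products preserve the property. *)
Lemma sec_comp p x s : asec x s -> asec x (fun y => comp p (s y)).
Proof.
move: x s; apply: (etale_map (f := comp p) (alg_etale O) (alg_etale O)) => x a.
suff [s [h1 h2 h3]] : exists s, [/\ asec x s, s x = a &
    forall p, asec x (fun y => comp p (s y))] by exists s; last exact: h3.
have eO := alg_etale O; have aB := @alg_secB _ _ O.
have const_deg q s : asec x s -> (forall y, odeg q (s y)) ->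
    exists t, [/\ asec x t, t x = s x & forall p, asec x (fun y => comp p (t y))].
  move=> hs hq; exists s; split=> // p'; case: (eqVneq p' q) => e.
    by apply: etale_eq hs _ => // y; rewrite (comp_deg _ (hq y)) e eqxx.
  apply: etale_eq (sec0 eO aB x) _ => // y.
  by rewrite (comp_deg _ (hq y)) (negPf e).
elim/ext_ind: a => [|f|g]; first 1 last.
- have [s hs <-] := etale_through (alg_etale F) f.
  by apply: (const_deg 0%N (fun y => inc (s y))) => [|y]; [exact: inc_sec | exact: ext_deg_inc].
- have [s hs <-] := etale_through (mod_etale G) g.
  by apply: (const_deg 1%N (fun y => io (s y))) => [|y]; [exact: io_sec | exact: ext_deg_io].
split.
- apply: (const_deg 0%N (fun=> 1)) => [|y]; first exact: alg_sec1.
  by rewrite -(inc1 y); exact: ext_deg_inc.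
- move=> a b [s [hs <- hs']] [t [ht <- ht']].
  exists (fun y => s y - t y); split=> [||q]; [exact: aB | by [] |].
  by apply: etale_eq (aB _ _ _ (hs' q) (ht' q)) _ => // y; rewrite compB.
- move=> a b [s [hs <- hs']] [t [ht <- ht']].
  exists (fun y => s y * t y); split=> [||q]; [exact: alg_secM | by [] |].
  apply: (etale_eq eO
    (s := fun y => \sum_(i < q.+1) comp i (s y) * comp (q - i) (t y))).
    by apply: (sec_sum eO aB) => i _; exact: alg_secM.
  by move=> y; rewrite compM.
Qed.

(** The odd part of a lift to [O x] lies in the odd ideal and dies under [pr]; the even part has
    even image. *)
Lemma F_even x (f : F x) : apar false f.
Proof.
have [[p1 pl pM pp _] psurj pker] := hF.
have [a <-] := psurj x f.
have [v [w [hv hw ->]]] := par_split (alg_super O) false a.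
have -> : pr (v + w) = pr v.
  rewrite -{1}[v]scale1r pl scale1r; suff -> : pr w = 0 by rewrite addr0.
  by apply/pker/sums1; exists 1, w, 1; rewrite mul1r mulr1.
exact: pp.
Qed.

Lemma ext_deg_par p x (a : O x) : odeg p a -> apar (odd p) a.
Proof.
have sO := alg_super O; have [[_ _ _ inc_par _] _ _ _] := hsplit.
move=> h; elim/sums_ind: a / h => [|b c [f [g ->]] hc]; first exact: (par0 sO).
apply: (parD sO) => // {c hc}; rewrite -[odd p]addFb; apply: alg_parM.
  exact/inc_par/F_even.
elim: p g => [|p IH] g; first by rewrite big_ord0; exact: alg_par1.
by rewrite big_ord_recl /= -addTb; apply: alg_parM => //; exact: io_odd.
Qed.

(** A homogeneous element has the parity of its degree. Group the components of [a] by parity: those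
    of the wrong parity sum to zero, since [a] has parity [b]. *)
Lemma comp_par b p x (a : O x) : apar b a -> apar b (comp p a).
Proof.
have sO := alg_super O.
have [a0 [a1 [-> h0 h1]]] : exists a0 a1, [/\ a = a0 + a1,
    forall p, apar b (comp p a0) /\ apar b a0 &
    forall p, apar (~~ b) (comp p a1) /\ apar (~~ b) a1].
  rewrite (comp_total a); elim/big_ind: _ => [|u v [u0 [u1 [-> hu0 hu1]]]
      [v0 [v1 [-> hv0 hv1]]]|q _].
  - exists 0, 0; rewrite addr0; split=> // q; rewrite comp0; split; exact: (par0 sO).
  - exists (u0 + v0), (u1 + v1); rewrite addrACA; split=> // q; rewrite compD;
      split; apply: (parD sO); by case: (hu0 q) (hu1 q) (hv0 q) (hv1 q) => ? ? [? ?] [? ?] [].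
  - have hq := compP q a; have hp := ext_deg_par hq.
    have hc c : odd q = c -> forall p', apar c (comp p' (comp q a)) /\ apar c (comp q a).
      move=> <- p'; split=> //; rewrite (comp_deg _ hq).
      by case: eqP => _ //; exact: (par0 sO).
    have h0 c : forall p', apar c (comp p' (0 : O x)) /\ apar c (0 : O x).
      by move=> p'; rewrite comp0; split; exact: (par0 sO).
    case: (eqVneq (odd q) b) => e.
      by exists (comp q a), 0; rewrite addr0; split=> //; exact: hc.
    exists 0, (comp q a); rewrite add0r; split=> //; apply: hc.
    by move: e; case: (odd q); case: b.
move=> h; suff -> : a1 = 0 by rewrite addr0; case: (h0 p).
have e : a1 = (a0 + a1) - a0 by rewrite addrC addKr.
apply: (par_uniq sO (b := b)); last by case: (h1 0%N).
by rewrite e; apply: (parB sO) => //; case: (h0 0%N).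
Qed.

Lemma prD x (a b : O x) : pr (a + b) = pr a + pr b.
Proof. by have [[_ h _ _ _] _ _] := hF; rewrite -{1}[a]scale1r h scale1r. Qed.

Lemma comp_total_leq x (a : O x) N : (size (gr a) <= N)%N ->
  a = \sum_(p < N) comp p a.
Proof.
move=> hN; rewrite [LHS]comp_total (big_ord_widen _ (fun p => comp p a) hN).
rewrite big_mkcond; apply: eq_bigr => p _; case: ltnP => // h.
by rewrite /comp nth_default.
Qed.

Lemma ext_deg_odd_ideal p x (a : O x) : odeg p.+1 a -> odd_ideal a.
Proof.
apply: sumsS => c [f [g ->]]; apply: sums1.
exists (inc f), (io (g ord0)), (\prod_(k < p) io (g (lift ord0 k))).
by rewrite big_ord_recl mulrA; split=> //; exact: io_odd.
Qed.

(** Components of positive degree lie in the odd ideal. Modulo it [a] is some [inc f], and [pr]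
    recovers [f] because [inc] is a section of [pr]. *)
Lemma odd_idealE x (a : O x) : odd_ideal a <-> comp 0 a = 0.
Proof.
have [_ _ pker] := hF.
have ea := comp_total_leq (leqnSn (size (gr a))).
rewrite big_ord_recl /= in ea; set r := \sum_(i < _) _ in ea.
have hr : odd_ideal r.
  by apply: sums_sum => i _; exact: ext_deg_odd_ideal (compP _ _).
split=> [ha|a0]; last by rewrite ea a0 add0r.
have : pr (comp 0 a + r) = 0 by rewrite -ea; apply/pker.
rewrite prD [X in _ + X](pker _ _).2 // addr0.
have [f ->] := ext_deg0E (compP 0 a).
by rewrite hinc => ->; exact: inc0.
Qed.

(** A nonzero term needs [i <= #|I|] and [j <= #|K :\: I|], and these cardinals add up to [#|K|]. *)
Lemma grassmann_mul_support (k i j : nat) (f g : {set 'I_k} -> R[i]) :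
  (forall I : {set 'I_k}, (#|I| < i)%N -> f I = 0) ->
  (forall I : {set 'I_k}, (#|I| < j)%N -> g I = 0) ->
  forall I : {set 'I_k}, (#|I| < i + j)%N -> grassmann_mul f g I = 0.
Proof.
move=> hf hg K hK; apply: big1 => I IK.
have [/hf ->|hi] := ltnP #|I| i; first by rewrite mulr0 mul0r.
rewrite hg ?mulr0 // cardsDS // -(ltn_add2l #|I|) subnKC ?subset_leq_card //.
by apply: leq_trans hK _; rewrite leq_add2r.
Qed.

(** A chart separates sections over open sets, not germs, so the product is shown to vanish on a
    whole neighbourhood. The coefficients of a product of [k] odd elements start at index sets of
    size [k], and ['I_m] has no subset that large. *)
Lemma prod_odd_sections k x (g : 'I_k -> forall y, G y) :
  (forall i, msec x (g i)) -> (m < k)%N ->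
  \prod_(i < k) io (g i x) = 0.
Proof.
move=> hg hmk; have [V [phi [theta [Vx [[oV _ _ _] [th1 thlin thM thpar] thsec]]]]] := hO x.
have : nbhs x (V `&` [set y | forall i, msec y (g i)]).
  apply: filterI; first exact: open_nbhs_nbhs.
  by apply: filter_forall => i; exact: (etale_open (mod_etale G) (hg i)).
rewrite nbhsE => -[W [oW Wx] WV].
have [_ thinj _] := thsec W oW (fun y h => (WV y h).1).
have th0 y I : V y -> theta y 0 I = 0.
  move=> Vy; have := thlin y Vy 1 0 0 I.
  by rewrite scale1r addr0 mul1r -[X in X = _]addr0 => /addrI.
have eO := alg_etale O.
apply: (thinj (fun y => \prod_(i < k) io (g i y)) (fun=> 0)) => //.
- move=> y Wy; have [_ hgy] := WV y Wy.
  elim: k g {hg hmk WV} hgy => [|k IH] g hg.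
    by apply: (etale_eq eO (alg_sec1 O y)) => z; rewrite big_ord0.
  apply: (etale_eq eO
    (s := fun z => io (g ord0 z) * \prod_(i < k) io (g (lift ord0 i) z))).
    by apply: alg_secM; [exact/io_sec | apply: IH].
  by move=> z; rewrite big_ord_recl.
- by move=> y _; exact: (sec0 eO (@alg_secB _ _ O)).
move=> y Wy I; rewrite th0; last exact: (WV y Wy).1.
have {}Vy := (WV y Wy).1.
suff H q (g' : 'I_q -> G y) : forall I : {set 'I_m}, (#|I| < q)%N ->
    theta y (\prod_(i < q) io (g' i)) I = 0.
  apply: H; apply: leq_ltn_trans hmk.
  by rewrite -[X in (_ <= X)%N]card_ord max_card.
elim: q g' => [|q IH] g' J hJ //.
rewrite big_ord_recl thM //; apply: (grassmann_mul_support (i := 1) (j := q)) => //;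
  last exact: IH.
move=> I'; rewrite ltnS leqn0 => /eqP hI'; apply: (thpar y Vy true) => //.
  exact: io_odd.
by rewrite hI'.
Qed.

Lemma ext_deg_max p x (a : O x) : (m < p)%N -> odeg p a -> a = 0.
Proof.
move=> hp h; elim/sums_ind: a / h => [//|a b [f [g ->]] ->]; rewrite addr0.
have /choice[s hs] i : exists s, msec x s /\ s x = g i.
  by have [s s1 s2] := etale_through (mod_etale G) (g i); exists s.
rewrite (eq_bigr (fun i => io (s i x))) => [|i _]; last by rewrite (hs i).2.
by rewrite prod_odd_sections ?mulr0 // => i; case: (hs i).
Qed.

(** In contrast with [comp_total], the number of summands is the same for all [a]. This makes the
    analogous statement for [Egr] closed under differences, and it bounds the filtration. *)
Lemma comp_sumE x (a : O x) : a = \sum_(p < m.+1) comp p a.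
Proof.
set N := maxn (size (gr a)) m.+1.
rewrite [LHS](@comp_total_leq _ _ N) ?leq_maxl //.
rewrite [RHS](big_ord_widen N (fun p => comp p a)) ?leq_maxr //.
rewrite [RHS]big_mkcond; apply: eq_bigr => p _; case: ltnP => // h.
exact: ext_deg_max (compP p a).
Qed.
(** * The filtration by powers of the odd ideal *)

Section Filtration.
Variable E : smod O.
Implicit Types (p q : nat).

Lemma filtr_subgroup p x : is_subgroup (@filtr _ _ _ E p x).
Proof.
elim: p => [|p [IH0 IHB]] //; split=> [|u v hu hv]; first exact: sums0.
apply: sumsD => //; apply: sumsN hv => w [j [v' [hj hv' ->]]].
exists j, (- v'); rewrite scalerN; split=> //.
by rewrite -sub0r; exact: IHB.
Qed.

Lemma filtr0 p x : @filtr _ _ _ E p x 0.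
Proof. by case: (filtr_subgroup p x). Qed.

Lemma filtrB p x (u v : E x) : filtr p u -> filtr p v -> filtr p (u - v).
Proof. by case: (filtr_subgroup p x) => _; exact. Qed.

Lemma filtrN p x (u : E x) : filtr p u -> filtr p (- u).
Proof. by move=> hu; rewrite -sub0r; apply/filtrB/hu/filtr0. Qed.

Lemma filtrD p x (u v : E x) : filtr p u -> filtr p v -> filtr p (u + v).
Proof. by move=> hu hv; rewrite -[v]opprK; apply/filtrB/filtrN. Qed.

Lemma filtr_sum p x (I : Type) (r : seq I) (P : pred I) (s : I -> E x) :
  (forall i, P i -> filtr p (s i)) -> filtr p (\sum_(i <- r | P i) s i).
Proof.
by move=> hs; apply: big_ind => //; [exact: filtr0 | move=> *; exact: filtrD].
Qed.

Lemma filtr_odd p x (j : O x) (u : E x) :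
  odd_ideal j -> filtr p u -> filtr p.+1 (j *: u).
Proof. by move=> hj hu; apply: sums1; exists j, u. Qed.

Lemma odd_idealMl x (a j : O x) : odd_ideal j -> odd_ideal (a * j).
Proof.
move=> h; elim/sums_ind: j / h => [|j k [b [c [d [hc ->]]]] hk].
  by rewrite mulr0; exact: sums0.
rewrite mulrDr; apply: sumsD => //; apply: sums1.
by exists (a * b), c, d; rewrite !mulrA.
Qed.

Lemma filtrZ p x (a : O x) (u : E x) : filtr p u -> filtr p (a *: u).
Proof.
case: p => [//|p] h; elim/sums_ind: u / h => [|u v [j [w [hj hw ->]]] hv].
  by rewrite scaler0; exact: sums0.
rewrite scalerDr scalerA; apply: sumsD => //.
by apply: filtr_odd => //; exact: odd_idealMl.
Qed.

Lemma filtrS p x (u : E x) : filtr p.+1 u -> filtr p u.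
Proof.
elim: p u => [//|p IH] u; apply: sumsS => v [j [w [hj hw ->]]].
by apply: sums1; exists j, w; split=> //; exact: IH.
Qed.

Lemma filtr_leq p q x (u : E x) : (p <= q)%N -> filtr q u -> filtr p u.
Proof.
by move=> /subnK <-; elim: (q - p)%N => [//|k IH]; rewrite addSn => /filtrS.
Qed.

Lemma filtr_ext_deg p q x (a : O x) (u : E x) :
  odeg q a -> filtr p u -> filtr (q + p) (a *: u).
Proof.
move=> + hu => h; elim/sums_ind: a / h => [|a b [f [g ->]] hb].
  by rewrite scale0r; exact: filtr0.
rewrite scalerDl; apply: filtrD => //; rewrite -scalerA; apply: filtrZ.
elim: q g {b hb} => [|q IH] g; first by rewrite big_ord0 scale1r.
rewrite big_ord_recl -scalerA; apply: filtr_odd; last exact: IH.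
by apply: (@ext_deg_odd_ideal 0); exact: ext_deg_io.
Qed.

(** Modulo the next step, step [p] of the filtration is spanned by products of [O_p] with [E]. On
    such products a linear map and a symbol map are both determined by what they do in degree 0. *)
Lemma filtr_generators p x (u : E x) : filtr p u ->
  exists v, sums [set w | exists a w', odeg p a /\ w = a *: w'] v /\
            filtr p.+1 (u - v).
Proof.
elim: p u => [|p IH] u h.
  exists u; rewrite subrr; split; last exact: filtr0.
  apply: sums1; exists 1, u; rewrite scale1r; split=> //.
  by rewrite -(inc1 x); exact: ext_deg_inc.
elim/sums_ind: u / h => [|u u' [j [w [hj hw ->]]] [v' [hv' huv']]].
  by exists 0; rewrite subrr; split; [exact: sums0 | exact: filtr0].
have [v [hv hwv]] := IH w hw.
(* Only the component of degree 1 of [j] counts: the rest of [j] starts in degree 2, and the error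
   [w - v] is already one step further. *)
exists (comp 1 j *: v + v'); split.
  apply: sumsD => //; elim/sums_ind: v / hv {hwv} => [|a b [c [d [hc ->]]] hb].
    by rewrite scaler0; exact: sums0.
  rewrite scalerDr scalerA; apply: sumsD => //; apply: sums1.
  by exists (comp 1 j * c), d; split=> //; apply: (@ext_degM 1) => //; exact: compP.
rewrite opprD addrACA; apply: filtrD => //.
have -> : j *: w - comp 1 j *: v = (j - comp 1 j) *: w + comp 1 j *: (w - v).
  by rewrite scalerBl scalerBr addrA subrK.
apply: filtrD; last by apply: (@filtr_ext_deg _ 1) => //; exact: compP.
have ej := comp_total_leq (leqW (leqnSn (size (gr j)))).
rewrite 2!big_ord_recl /= ((odd_idealE _).1 hj) add0r in ej.
rewrite [X in X - _]ej addrAC subrr add0r scaler_suml.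
apply: filtr_sum => i _; apply: (@filtr_leq _ (i.+2 + p)).
  by rewrite !addSn !ltnS leq_addl.
exact: filtr_ext_deg (compP _ _) hw.
Qed.

Lemma filtr_nilpotent x (u : E x) : filtr m.+1 u -> u = 0.
Proof.
(* The coefficients [a] are tracked too: they have no component below degree [p]. At [p = m.+1] all
   the components listed by [comp_sumE] vanish. *)
suff H p : filtr p u -> sums [set w | exists (a : O x) (w' : E x),
    (forall q, (q < p)%N -> comp q a = 0) /\ w = a *: w'] u.
  move=> /H h; elim/sums_ind: u / h {H} => [//|u v [a [w [ha ->]]] ->].
  by rewrite addr0 [a]comp_sumE big1 ?scale0r // => q _; exact: ha.
elim: p u => [|p IH] u.
  by move=> _; apply: sums1; exists 1, u; rewrite scale1r.
apply: sumsS => v [j [w [/odd_idealE hj /IH hw ->]]].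
elim/sums_ind: w / hw => [|w w' [a [u' [ha ->]]] hw'].
  by rewrite scaler0; exact: sums0.
rewrite scalerDr scalerA; apply: sumsD => //; apply: sums1.
exists (j * a), u'; split=> // q hq; rewrite compM big1 // => -[[|i] /= hi] _.
  by rewrite hj mul0r.
by rewrite ha ?mulr0 //; rewrite ltnS in hq; apply: leq_trans hq; rewrite ltn_subrL; case: (q) hi.
Qed.

End Filtration.

(** * The grading of the tensor product *)

Variables (S : smod F) (Egr : smod O) (ten : forall x : M, O x -> S x -> Egr x).
Hypothesis hE : tensor_product (@inc) ten.
Local Arguments ten {x}.
Local Notation deg := (ten_deg (@inc) (@io) (@ten)).

Lemma tenDl x (a b : O x) (s : S x) : ten (a + b) s = ten a s + ten b s.
Proof. by have [[h _ _ _] _ _ _] := hE; exact: h. Qed.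

Lemma tenDr x (a : O x) (s t : S x) : ten a (s + t) = ten a s + ten a t.
Proof. by have [[_ h _ _] _ _ _] := hE; exact: h. Qed.

Lemma ten_inc x (a : O x) (f : F x) (s : S x) : ten (a * inc f) s = ten a (f *: s).
Proof. by have [[_ _ h _] _ _ _] := hE; exact: h. Qed.

Lemma tenZ x (a b : O x) (s : S x) : ten (a * b) s = a *: ten b s.
Proof. by have [[_ _ _ h] _ _ _] := hE; exact: h. Qed.

Lemma ten0l x (s : S x) : ten (0 : O x) s = 0.
Proof. by rewrite -(mulr0 0) tenZ scale0r. Qed.

Lemma tenE x (a : O x) (s : S x) : ten a s = a *: ten 1 s.
Proof. by rewrite -tenZ mulr1. Qed.

Lemma tensor_map x (B : zmodType) (h : O x -> S x -> B) :
  (forall a b s, h (a + b) s = h a s + h b s) ->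
  (forall a s t, h a (s + t) = h a s + h a t) ->
  (forall a f s, h (a * inc f) s = h a (f *: s)) ->
  exists Phi : Egr x -> B, (forall u v, Phi (u + v) = Phi u + Phi v) /\
    forall a s, Phi (ten a s) = h a s.
Proof.
have [_ _ _ univ] := hE => h1 h2 h3.
by have [Phi [hPhi _]] := univ x B h h1 h2 h3; exists Phi.
Qed.

(** Corestricting [ten] to the subgroup cut out by [P] and mapping back gives the identity, by
    uniqueness in the universal property. *)
Lemma ten_ind x (P : Egr x -> Prop) : is_subgroup P ->
  (forall a s, P (ten a s)) -> forall t, P t.
Proof.
move=> hP Pten t; have [_ _ _ univ] := hE.
have inP a s : ten a s \in subgroup_pred hP by apply/asboolP.
have [|||Phi [PhiD Phiten]] := @tensor_map x (subgroup_of hP)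
  (fun a s => SubgroupOf (inP a s)).
- by move=> a b s; apply: val_inj; rewrite raddfD /= tenDl.
- by move=> a s s'; apply: val_inj; rewrite raddfD /= tenDr.
- by move=> a f s; apply: val_inj; rewrite /= ten_inc.
have [Psi [_ hU]] := univ x (Egr x) (@ten x) (@tenDl x) (@tenDr x) (@ten_inc x).
have e1 : Psi = val \o Phi.
  by apply: hU; split=> [u v|a s] /=; rewrite ?PhiD ?Phiten // raddfD.
have e2 : Psi = id by apply: hU.
have -> : t = val (Phi t) by rewrite -[val _]/((val \o Phi) t) -e1 e2.
by have /asboolP := subgroup_valP (Phi t).
Qed.

Lemma proj_exists p x : exists Phi : Egr x -> Egr x,
  (forall u v, Phi (u + v) = Phi u + Phi v) /\
  forall a s, Phi (ten a s) = ten (comp p a) s.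
Proof.
apply: tensor_map => [a b s|a s t|a f s].
- by rewrite compD tenDl.
- by rewrite tenDr.
- by rewrite comp_mulinc ten_inc.
Qed.

Definition proj p x : Egr x -> Egr x := projT1 (cid (proj_exists p x)).
Definition proj_spec p x := projT2 (cid (proj_exists p x)).

Lemma projD p x (u v : Egr x) : proj p (u + v) = proj p u + proj p v.
Proof. by case: (proj_spec p x) => h _; exact: h. Qed.

Lemma proj_ten p x (a : O x) (s : S x) : proj p (ten a s) = ten (comp p a) s.
Proof. by case: (proj_spec p x) => _ h; exact: h. Qed.

Lemma proj0 p x : proj p (0 : Egr x) = 0.
Proof. by apply: (addrI (proj p 0)); rewrite -projD !addr0. Qed.

Lemma projB p x (u v : Egr x) : proj p (u - v) = proj p u - proj p v.
Proof. by apply/eqP; rewrite eq_sym subr_eq -projD subrK. Qed.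

Lemma proj_sum p x (I : Type) (r : seq I) (P : pred I) (t : I -> Egr x) :
  proj p (\sum_(i <- r | P i) t i) = \sum_(i <- r | P i) proj p (t i).
Proof.
by apply: (big_morph (@proj p x)) => [*|]; [exact: projD | exact: proj0].
Qed.

Lemma deg_ten p x (a : O x) (s : S x) : odeg p a -> deg p (ten a s).
Proof. by move=> ha; apply: sums1; exists a, s. Qed.

Lemma degN p x (t : Egr x) : deg p t -> deg p (- t).
Proof.
apply: sumsN => _ [a [s [ha ->]]]; exists (- a), s; split; first exact: ext_degN.
by rewrite tenE [RHS]tenE scaleNr.
Qed.

Lemma degB p x (t u : Egr x) : deg p t -> deg p u -> deg p (t - u).
Proof. by move=> ht hu; apply/sumsD/degN. Qed.

Lemma deg_proj p x (t : Egr x) : deg p (proj p t).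
Proof.
elim/ten_ind: t => [|a s].
  split=> [|u v hu hv]; first by rewrite proj0; exact: sums0.
  by rewrite projB; exact: degB.
by rewrite proj_ten; apply/deg_ten/compP.
Qed.

Lemma projE p q x (t : Egr x) : deg p t -> proj q t = if q == p then t else 0.
Proof.
move=> h; elim/sums_ind: t / h => [|t u [a [s [ha ->]]] hu].
  by rewrite proj0; case: ifP.
rewrite projD hu proj_ten (comp_deg _ ha); case: eqP => // _.
by rewrite ten0l addr0.
Qed.

Lemma proj_sumE x (t : Egr x) : t = \sum_(p < m.+1) proj p t.
Proof.
elim/ten_ind: t => [|a s].
  split=> [|u v hu hv]; first by rewrite big1 // => p _; exact: proj0.
  rewrite [in LHS]hu [in LHS]hv -sumrB.
  by apply: eq_bigr => p _; rewrite projB.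
rewrite [in LHS](comp_sumE a) (big_morph (fun b => ten b s) (fun a b => tenDl a b s) (ten0l s)).
by apply: eq_bigr => p _; rewrite proj_ten.
Qed.

Lemma degZ p q x (a : O x) (t : Egr x) : odeg p a -> deg q t -> deg (p + q) (a *: t).
Proof.
move=> ha h; elim/sums_ind: t / h => [|t u [b [s [hb ->]]] hu].
  by rewrite scaler0; exact: sums0.
rewrite scalerDr -tenZ; apply: sumsD => //.
by apply/deg_ten/ext_degM.
Qed.

Lemma deg0E x (t : Egr x) : deg 0 t -> exists s, t = ten 1 s.
Proof.
move=> h; elim/sums_ind: t / h => [|t u [a [s [ha ->]]] [s' ->]].
  by exists 0; apply: (addrI (ten 1 0)); rewrite -tenDr !addr0.
have [f ->] := ext_deg0E ha.
by exists (f *: s + s'); rewrite tenDr -ten_inc mul1r.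
Qed.

(** A homogeneous [t] need not come with a presentation by tensors of its own parity. An arbitrary
    presentation splits into a part of parity [b] and a part of the other parity, and the latter
    sums to zero. *)
Lemma ten_map_par (A : smod O) x (f : Egr x -> A x) :
  (forall u v, f (u - v) = f u - f v) ->
  (forall c d a s, apar c a -> mpar d s -> mpar (c (+) d) (f (ten a s))) ->
  forall b t, mpar b t -> mpar b (f t).
Proof.
move=> fB ften b t; have [_ ten_par _ _] := hE.
have sE := mod_super Egr; have sA := mod_super A.
have f0 : f 0 = 0 by have := fB 0 0; rewrite !subrr.
have fD u v : f (u + v) = f u + f v.
  by rewrite -[v]opprK fB -[in RHS]sub0r fB f0 sub0r.
have [t0 [t1 [-> h0 h1]]] : exists t0 t1, [/\ t = t0 + t1,
    mpar b t0 /\ mpar b (f t0) & mpar (~~ b) t1 /\ mpar (~~ b) (f t1)].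
  elim/ten_ind: t => [|a s].
    split=> [|t u [t0 [t1 [-> [? ?] [? ?]]]] [u0 [u1 [-> [? ?] [? ?]]]]].
      by exists 0, 0; rewrite addr0 f0; do !split;
        solve [exact: (par0 sE) | exact: (par0 sA)].
    exists (t0 - u0), (t1 - u1); rewrite opprD addrACA !fB.
    by do !split; solve [exact: (parB sE) | exact: (parB sA)].
  have [a0 [a1 [ha0 ha1 ->]]] := par_split (alg_super O) false a.
  have [s0 [s1 [hs0 hs1 ->]]] := par_split (mod_super S) b s.
  exists (ten a0 s0 + ten a1 s1), (ten a0 s1 + ten a1 s0).
  have hT c d (a' : O x) (s' : S x) : apar c a' -> mpar d s' ->
      mpar (c (+) d) (ten a' s') /\ mpar (c (+) d) (f (ten a' s')).
    by move=> ha' hs'; split; [exact: ten_par | exact: ften].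
  have [p1 q1] := hT _ _ _ _ ha0 hs0; have [+ +] := hT _ _ _ _ ha1 hs1;
    rewrite -[~~ _ (+) _]/(~~ ~~ b) negbK => p2 q2.
  have [p3 q3] := hT _ _ _ _ ha0 hs1; have [p4 q4] := hT _ _ _ _ ha1 hs0.
  rewrite !fD; split; first by rewrite tenDl !tenDr [ten a1 s0 + _]addrC addrACA.
  - by split; [exact: (parD sE) | exact: (parD sA)].
  - by split; [exact: (parD sE) | exact: (parD sA)].
move=> h; suff -> : t1 = 0 by rewrite addr0; case: h0.
apply: (par_uniq sE (b := b)); last by case: h1.
have -> : t1 = (t0 + t1) - t0 by rewrite addrC addKr.
by apply: (parB sE) => //; case: h0.
Qed.

Lemma proj_par b p x (t : Egr x) : mpar b t -> mpar b (proj p t).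
Proof.
apply: ten_map_par => [u v|c d a s ha hs]; first exact: projB.
have [_ ten_par _ _] := hE.
by rewrite proj_ten; apply: ten_par => //; exact: comp_par.
Qed.

Lemma ten_sec x a s : asec x a -> msec x s -> msec x (fun y => ten (a y) (s y)).
Proof. by have [_ _ h _] := hE; exact: h. Qed.

Lemma ten_map_sec (A : smod O) (f : forall x, Egr x -> A x) :
  (forall x u v, f x (u - v) = f x u - f x v) ->
  (forall x a s, asec x a -> msec x s -> msec x (fun y => f y (ten (a y) (s y)))) ->
  forall x t, msec x t -> msec x (fun y => f y (t y)).
Proof.
move=> fB ften.
have eE := mod_etale Egr; have eA := mod_etale A.
apply: (etale_map eE eA) => x t; elim/ten_ind: t => [|a s].
  split.
    exists (fun=> 0); first by split=> //; exact: (sec0 eE (@mod_secB _ _ _ Egr)).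
    apply: (etale_eq eA (sec0 eA (@mod_secB _ _ _ A) x)) => y.
    by have := fB y 0 0; rewrite !subrr.
  move=> t u [t' [ht <-] hft] [u' [hu <-] hfu].
  exists (fun y => t' y - u' y); first by split=> //; exact: mod_secB.
  by apply: (etale_eq eA (mod_secB hft hfu)) => y; rewrite fB.
have [a' ha <-] := etale_through (alg_etale O) a.
have [s' hs <-] := etale_through (mod_etale S) s.
by exists (fun y => ten (a' y) (s' y)); [split=> //; exact: ten_sec | exact: ften].
Qed.

Lemma proj_sec p x t : msec x t -> msec x (fun y => proj p (t y)).
Proof.
move: x t; apply: (ten_map_sec (f := proj p)) => [x u v|x a s ha hs]; first exact: projB.
have h := ten_sec (sec_comp p ha) hs.
by apply: (etale_eq (mod_etale Egr) h) => y; rewrite proj_ten.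
Qed.

Lemma filtr_deg p q x (t : Egr x) : (p <= q)%N -> deg q t -> filtr p t.
Proof.
move=> hpq h; apply: filtr_leq hpq _.
elim/sums_ind: t / h => [|t u [a [s [ha ->]]] hu]; first exact: filtr0.
apply: filtrD => //; rewrite tenE -[q]addn0.
exact: filtr_ext_deg.
Qed.

(** An element of the odd ideal starts in degree 1, so each such factor raises the lowest degree
    present by at least one. Conversely a tensor of degree [q] is an element of [O_q] times a germ,
    hence lies in step [q]. *)
Lemma filtrE p x (t : Egr x) : filtr p t <-> forall q, (q < p)%N -> proj q t = 0.
Proof.
split=> [|h]; last first.
  rewrite [t]proj_sumE; apply: filtr_sum => q _.
  case: (ltnP q p) => hq; first by rewrite h //; exact: filtr0.
  exact: filtr_deg hq (deg_proj _ _).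
elim: p t => [//|p IH] t h q hq.
elim/sums_ind: t / h => [|t u [j [v [/odd_idealE hj /IH hv ->]]] hu].
  exact: proj0.
rewrite projD hu addr0 [j]comp_sumE scaler_suml proj_sum big1 // => -[[|i] /= hi] _.
  by rewrite hj scale0r proj0.
rewrite [v]proj_sumE scaler_sumr proj_sum big1 // => -[r /= hr] _.
have hir := degZ (compP i.+1 j) (deg_proj r v).
rewrite (projE _ hir); case: eqP => // eq.
rewrite hv ?scaler0 //; move: hq; rewrite eq addSn !ltnS.
by apply: leq_ltn_trans; rewrite leq_addl.
Qed.

(** * Symbols and adapted isomorphisms *)

(* A symbol map is a retract identification [h] read off on elements instead of
   cosets: [cl p v] is the image under [h p] of the class of [v]. *)
Definition symbol (E : smod O) (cl : nat -> forall x, E x -> Egr x) : Prop :=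
  [/\ forall p x (u v : E x), filtr p u -> filtr p v ->
        cl p x (u + v) = cl p x u + cl p x v,
      forall p q x (a : O x) (v : E x), odeg q a -> filtr p v ->
        a *: cl p x v = cl (p + q)%N x (a *: v),
      forall b p x (v : E x), filtr p v -> mpar b v -> mpar b (cl p x v),
      forall p x s, msec x s -> (\forall y \near x, filtr p (s y)) ->
        msec x (fun y => cl p y (s y))
    & forall p x,
      [/\ forall v : E x, filtr p v -> deg p (cl p x v),
          forall w, deg p w -> exists2 v : E x, filtr p v & cl p x v = w
        & forall v : E x, filtr p v -> (cl p x v = 0 <-> filtr p.+1 v)]].

Lemma coset_eqP (E : smod O) p x (u v : E x) :
  coset (@filtr _ _ _ E p x) u = coset (@filtr _ _ _ E p x) v <-> filtr p (u - v).
Proof.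
split=> [e|h].
  have : coset (@filtr _ _ _ E p x) u u by rewrite /coset /= subrr; exact: filtr0.
  by rewrite e.
apply/seteqP; split=> w; rewrite /coset /= => hw.
  by rewrite -(subrK u w) -addrA; exact: filtrD.
by rewrite -(subrK v w) -addrA; apply: filtrD => //; rewrite -opprB; exact: filtrN.
Qed.

Lemma retractP (E : smod O) :
  retract_is odeg E deg <-> exists cl, @symbol E cl.
Proof.
split=> [[h [hbij hD hZ hpar hsec]]|[cl [hD hZ hpar hsec hcl]]].
  exists (fun p x v => h p x (coset (@filtr _ _ _ E p.+1 x) v)); split=> // p x.
  have [hfun hinj hsurj] := hbij p x.
  have h0 : h p x (coset (@filtr _ _ _ E p.+1 x) 0) = 0.
    apply: (addrI (h p x (coset (@filtr _ _ _ E p.+1 x) 0))).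
    by rewrite -hD ?addr0 //; exact: filtr0.
  split=> [v hv|w /hsurj[_ [v hv <-] <-]|v hv]; [by apply: hfun; exists v | by exists v |].
  rewrite -h0; split=> [/hinj e|hv'].
    rewrite -[v]subr0; apply/coset_eqP/e; apply/mem_set; first by exists v.
    by exists 0 => //; exact: filtr0.
  by congr (h p x); apply/coset_eqP; rewrite subr0.
(* On a coset, [h p] is [cl p] of a chosen representative; since [cl p] is additive and kills the
   next step of the filtration, any other choice gives the same value. *)
pose h p x (C : set (E x)) :=
  cl p x (xget 0 [set v | filtr p v /\ coset (@filtr _ _ _ E p.+1 x) v = C]).
have hE' p x v : filtr p v -> h p x (coset (@filtr _ _ _ E p.+1 x) v) = cl p x v.
  move=> hv; rewrite /h; case: xgetP => [w _ [hw /coset_eqP hwv]|/(_ v)]; last by case.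
  rewrite -[w](subrK v) hD //; last exact: filtrB.
  have [_ _ hk] := hcl p x.
  by rewrite (hk _ _).2 ?add0r //; exact: filtrB.
exists h; split.
- move=> p x; have [c1 c2 c3] := hcl p x; split.
  + by move=> _ [v hv <-]; rewrite hE' //; exact: c1.
  + move=> _ _ /set_mem[u hu <-] /set_mem[v hv <-]; rewrite !hE' // => e.
    apply/coset_eqP; apply/(c3 _ (filtrB hu hv)).
    apply: (addIr (cl p x v)); rewrite -hD ?subrK ?add0r //.
    exact: filtrB.
  + move=> w /c2[v hv <-]; exists (coset (@filtr _ _ _ E p.+1 x) v).
      by exists v.
    exact: hE'.
- by move=> p x u v hu hv; rewrite !hE' ?hD //; exact: filtrD.
- move=> p q x a v ha hv; have h' : filtr (p + q) (a *: v).
    by rewrite addnC; exact: filtr_ext_deg.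
  by rewrite !hE' //; exact: hZ.
- by move=> b p x v hv hb; rewrite hE' //; exact: hpar.
- move=> p x s hs hp; apply: (etale_near (mod_etale Egr) (hsec p x s hs hp)).
  by apply: filterS hp => y hy; rewrite hE'.
Qed.

Section Adapted.
Variables (E : smod O) (cl : nat -> forall x, E x -> Egr x).
Hypothesis hcl : symbol cl.

Lemma cl0D x (u v : E x) : cl 0 (u + v) = cl 0 u + cl 0 v.
Proof. by case: hcl => h _ _ _ _; exact: h. Qed.

Lemma cl0_0 x : cl 0 (0 : E x) = 0.
Proof. by apply: (addrI (cl 0 (0 : E x))); rewrite -cl0D !addr0. Qed.

Lemma cl0B x (u v : E x) : cl 0 (u - v) = cl 0 u - cl 0 v.
Proof. by apply/eqP; rewrite eq_sym subr_eq -cl0D subrK. Qed.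

Lemma cl0_sum x (I : Type) (r : seq I) (P : pred I) (u : I -> E x) :
  cl 0 (\sum_(i <- r | P i) u i) = \sum_(i <- r | P i) cl 0 (u i).
Proof.
by apply: (big_morph (@cl 0%N x)) => [*|]; [exact: cl0D | exact: cl0_0].
Qed.

(** The part of [a] of positive degree lies in the odd ideal and moves [u] into [filtr 1], the
    kernel of [cl 0]. *)
Lemma cl0Z x (a : O x) (u : E x) : cl 0 (a *: u) = comp 0 a *: cl 0 u.
Proof.
have [_ hZ _ _ hk] := hcl; have [_ _ hker] := hk 0%N x.
rewrite (hZ _ _ _ _ _ (compP 0 a)) // -[a in LHS](subrK (comp 0 a)) scalerDl cl0D.
rewrite (hker _ _).2 ?add0r //; apply: filtr_odd => //; apply/odd_idealE.
by rewrite compB (comp_deg _ (compP 0 a)) eqxx subrr.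
Qed.

Section OneStalk.
Variables (x : M) (f : E x -> Egr x).
Hypothesis f_lin : forall (a : O x) u v, f (a *: u + v) = a *: f u + f v.
Hypothesis f_cl : forall v, filtr 1 (f v - cl 0 v).

Let fD u v : f (u + v) = f u + f v.
Proof. by have := f_lin 1 u v; rewrite !scale1r. Qed.

Let f0 : f 0 = 0.
Proof. by apply: (addrI (f 0)); rewrite -fD !addr0. Qed.

Let fZ (a : O x) u : f (a *: u) = a *: f u.
Proof. by have := f_lin a u 0; rewrite f0 !addr0. Qed.

Let fB u v : f (u - v) = f u - f v.
Proof. by apply/eqP; rewrite eq_sym subr_eq -fD subrK. Qed.

Let f_filtr p u : filtr p u -> filtr p (f u).
Proof.
elim: p u => [//|p IH] u h.
elim/sums_ind: u / h => [|u v [j [w [hj hw ->]]] hv].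
  by rewrite f0; exact: sums0.
by rewrite fD fZ; apply: sumsD => //; apply: filtr_odd => //; exact: IH.
Qed.

(** Agreement in degree 0 propagates: by [filtr_generators] it is enough to treat [a *: w'] with [a]
    in [O_p], where the difference is [a] times the difference in degree 0. *)
Lemma adapted_symbol p (v : E x) : filtr p v -> filtr p.+1 (f v - cl p v).
Proof.
have [hD hZ _ _ hk] := hcl; have [_ _ hker] := hk p x.
move=> hv; have [w [hw hvw]] := filtr_generators hv.
have hpw : filtr p w by rewrite -(subKr v w); apply: filtrB => //; exact: filtrS.
rewrite -(subrK w v) fD hD //; last exact: filtrS.
rewrite (hker _ (filtrS hvw)).2 // add0r -addrA; apply: filtrD.
  exact: f_filtr.
have [] : filtr p w /\ filtr p.+1 (f w - cl p w); last by [].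
elim/sums_ind: w / hw {hpw hvw} => [|u u' [a [w' [ha ->]]] [h1 h2]].
  split; first exact: filtr0.
  by rewrite f0 sub0r; apply: filtrN; rewrite (hker _ _).2; exact: filtr0.
have hp : filtr p (a *: w') by rewrite -[p]addn0; apply: filtr_ext_deg.
split; first exact: filtrD.
rewrite fD hD // opprD addrACA; apply: filtrD => //.
rewrite fZ -[X in cl X]add0n -(hZ 0%N) // -scalerBr -addn1.
exact: filtr_ext_deg.
Qed.

Lemma adapted_bij : bijective f.
Proof.
have [_ _ _ _ hk] := hcl.
have f_inj : injective f.
  move=> u v e; apply/subr0_eq.
  have {e} : f (u - v) = 0 by rewrite fB e subrr.
  (* An element of the kernel has zero symbol in each degree, so it descends through the filtration
     down to the trivial step. *)
  move: (u - v) => {u v} w hw; apply: filtr_nilpotent.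
  elim: m.+1 => [//|p hp]; have [hdeg _ hker] := hk p x.
  apply/hker => //; have := adapted_symbol hp.
  rewrite hw sub0r => /filtrN; rewrite opprK => /filtrE/(_ p (ltnSn p)).
  by rewrite (projE _ (hdeg _ hp)) eqxx.
have f_surj w : exists v, f v = w.
  (* Induction from the bottom of the filtration, [filtr m.+1] being zero: a lift of the leading
     component of [w'] is mapped by [f] and subtracted, which leaves a remainder one step deeper. *)
  suff H k w' : filtr (m.+1 - k) w' -> exists v, f v = w'.
    by apply: (H m.+1); rewrite subnn.
  elim: k w' => [|k IH] w' hw.
    by exists 0; rewrite f0; apply/esym/filtr_nilpotent; rewrite subn0 in hw.
  set p := (m.+1 - k.+1)%N in hw; have [_ hs _] := hk p x.
  have [v hv ev] := hs _ (deg_proj p w').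
  have [|v' hv'] := IH (w' - f v); last by exists (v' + v); rewrite fD hv' subrK.
  apply: (@filtr_leq _ _ p.+1); first by rewrite /p subnS; case: (m.+1 - k)%N.
  rewrite -(subrK (cl p v) w') -addrA; apply: filtrD; last first.
    by rewrite -opprB; apply/filtrN/adapted_symbol.
  rewrite ev; apply/filtrE => q; rewrite ltnS leq_eqVlt => /orP[/eqP->|hq].
    by rewrite projB (projE _ (deg_proj p w')) eqxx subrr.
  rewrite projB (projE _ (deg_proj p w')) (ltn_eqF hq) subr0.
  by move/filtrE: hw; exact.
have /choice[g gK] := f_surj.
by exists g => // u; apply: f_inj.
Qed.

End OneStalk.
End Adapted.

(** * Cocycles of locally free sheaves *)

Definition adapted (E : smod O) (cl : nat -> forall x, E x -> Egr x) (U : set M)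
    (phi : forall x, E x -> Egr x) : Prop :=
  smod_iso_on U phi /\ forall x, U x -> forall v, filtr 1 (phi x v - cl 0%N x v).

Local Notation cochain := (@cochain M (stalks Egr)).
Local Notation cocycle := (@cocycle M (stalks Egr) (@Aut1 R M O Egr)).
Local Notation cohomologous := (@cohomologous M (stalks Egr) (@Aut1 R M O Egr)).
Local Notation cohomology_class :=
  (@cohomology_class M (stalks Egr) (@Aut1 R M O Egr)).

Local Notation zval z i j x v := (@Defs.val M (stalks Egr) z i j x v).

(** As a predicate on cochains, [glues cl] will be the cohomology class attached to [cl]:
    [glues_class] identifies it with the class of each of its members. *)
Definition glues (E : smod O) (cl : nat -> forall x, E x -> Egr x)
    (z : cochain) : Prop :=
  open_cover (@cov _ _ z) /\
  exists phi : idx z -> forall x, E x -> Egr x,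
    (forall i, adapted cl (cov i) (phi i)) /\
    forall i j x, (cov i `&` cov j) x -> forall v,
      zval z i j x (phi j x v) = phi i x v.

(** The coordinates of [v] are kept and each basis vector [e j] is replaced by its symbol. As [cl 0]
    reads coordinates through [comp 0], the two differ by elements of the odd ideal times symbols;
    bijectivity then comes from [adapted_bij]. *)
Lemma adapted_local (E : smod O) cl (x : M) : locally_free E -> @symbol E cl ->
  exists U phi, [/\ open U, U x & adapted cl U phi].
Proof.
move=> lfE hcl; have [p [q [U [chi [oU Ux hchi]]]]] := lfE x.
have hinv := iso_inv_iso hchi oU.
pose e j y := chi y (basis_vec O j y).
pose r y (v : E y) (j : 'I_(p + q)) : O y :=
  (iso_inv chi v : 'rV[O y]_(p + q)) ord0 j.
pose phi y (v : E y) := \sum_j r y v j *: cl 0%N y (e j y).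
have phi_lin y : U y -> forall (a : O y) u v, phi y (a *: u + v) = a *: phi y u + phi y v.
  move=> Uy a u v; rewrite scaler_sumr -big_split; apply: eq_bigr => j _ /=.
  by rewrite /r (iso_lin hinv) // !mxE scalerDl scalerA.
have phi_cl y : U y -> forall v, filtr 1 (phi y v - cl 0%N y v).
  move=> Uy v.
  have {2}-> : v = \sum_j r y v j *: e j y.
    by rewrite -[LHS](Kiso_inv hchi v Uy) (free_iso_sum hchi).
  rewrite (cl0_sum hcl) -sumrB; apply: filtr_sum => j _.
  rewrite (cl0Z hcl) -scalerBl; apply: filtr_odd => //; apply/odd_idealE.
  by rewrite compB (comp_deg _ (compP 0 _)) eqxx subrr.
exists U, phi; split=> //; split=> //; split=> // [y Uy|b y Uy v hv|y Uy s hs].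
- exact: (adapted_bij hcl (phi_lin y Uy) (phi_cl y Uy)).
- apply: (par_sum (mod_super Egr)) => j _.
  have hr : apar (b (+) (p <= j)%N) (r y v j) by exact: (iso_par hinv Uy hv).
  have he : mpar (p <= j)%N (e j y).
    exact/(iso_par hchi Uy)/basis_vec_par.
  have [_ _ hpar _ _] := hcl.
  by have := mod_parZ hr (hpar _ 0%N _ _ I he); rewrite addbK.
- apply: (sec_sum (mod_etale Egr) (@mod_secB _ _ _ Egr)) => j _.
  have he : msec y (e j) by exact/(iso_sec hchi Uy)/basis_vec_sec.
  have [_ _ _ hsec _] := hcl.
  apply: mod_secZ; first exact: (iso_sec hinv Uy hs).
  by apply: hsec => //; exact: nearW.
Qed.

Lemma glues_exists (E : smod O) cl : locally_free E -> @symbol E cl ->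
  exists z, glues cl z.
Proof.
move=> lfE hcl.
have /choice[U] x := adapted_local x lfE hcl.
move=> /choice[phi hphi].
exists (@Cochain M (stalks Egr) M U (fun i j x v => phi i x (iso_inv (phi j) v))).
split; first by split=> [i|x]; [case: (hphi i) | exists x; case: (hphi x)].
exists phi; split=> [i|i j x [_ xj] v] /=; first by case: (hphi i).
by congr (phi i x); apply: iso_invK xj; case: (hphi j) => _ _ [].
Qed.

Section Glues.
Variables (E : smod O) (cl : nat -> forall x, E x -> Egr x).

Lemma adapted_Aut1 U (phi psi : forall x, E x -> Egr x) : open U ->
  adapted cl U phi -> adapted cl U psi ->
  Aut1 U (fun x w => psi x (iso_inv phi w)).
Proof.
move=> oU [hphi phi1] [hpsi psi1]; split.
  exact: iso_comp (iso_inv_iso hphi oU) hpsi.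
move=> x Ux w; rewrite -{2}(Kiso_inv hphi w Ux).
set v := iso_inv _ _.
rewrite -(subrK (cl 0 v) (psi x v)) -addrA; apply: filtrD; first exact: psi1.
by rewrite -opprB; apply/filtrN/phi1.
Qed.

Lemma Aut1_local U (phi : forall x, Egr x -> Egr x) :
  (forall x, U x -> exists V psi, [/\ open V, V x, @Aut1 R M O Egr V psi
     & forall y, V y -> forall u, phi y u = psi y u]) ->
  @Aut1 R M O Egr U phi.
Proof.
move=> h; split.
  by apply: iso_local => x /h[V [psi [? ? [? _] ?]]]; exists V, psi.
by move=> x /h[V [psi [? ? [_ h1] e]]] v; rewrite e //; exact: h1.
Qed.

Lemma adapted_sub U V phi : V `<=` U -> adapted cl U phi -> adapted cl V phi.
Proof.
by move=> VU [h1 h2]; split; [exact: (iso_sub h1) | move=> x /VU; exact: h2].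
Qed.

Lemma adapted_comp U phi (a : forall x, Egr x -> Egr x) :
  adapted cl U phi -> @Aut1 R M O Egr U a -> adapted cl U (fun x v => a x (phi x v)).
Proof.
move=> [h1 h2] [a1 a2]; split; first exact: iso_comp h1 a1.
move=> x Ux v; rewrite -(subrK (phi x v) (a x _)) -addrA.
by apply: filtrD; [exact: a2 | exact: h2].
Qed.

Lemma adapted_iso_local U phi :
  (forall x, U x -> exists V psi, [/\ open V, V x, adapted cl V psi
     & forall y, V y -> forall u, phi y u = psi y u]) ->
  adapted cl U phi.
Proof.
move=> h; split.
  by apply: iso_local => x /h[V [psi [? ? [? _] ?]]]; exists V, psi.
by move=> x /h[V [psi [? ? [_ h1] e]]] v; rewrite e //; exact: h1.
Qed.

Lemma glues_cocycle z : glues cl z -> cocycle z.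
Proof.
move=> [[oU cU] [phi [hphi e]]].
have vE i j x (w : Egr x) : (cov i `&` cov j) x ->
    zval z i j x w = phi i x (iso_inv (phi j) w).
  move=> ijx; rewrite -[X in zval _ _ _ _ X](Kiso_inv (hphi j).1 w ijx.2).
  exact: e.
split=> // [i j|i j k x [[ix jx] kx] v]; last first.
  by rewrite !vE // (iso_invK (hphi j).1).
apply: Aut1_local => x ijx; exists (cov i `&` cov j).
exists (fun x w => phi i x (iso_inv (phi j) w)); split=> //.
- exact: openI.
- apply: adapted_Aut1; first exact: openI.
    by apply: adapted_sub (hphi j) => y [].
  by apply: adapted_sub (hphi i) => y [].
- by move=> y ijy u; exact: vE.
Qed.

(** On the refinement by all pairwise intersections, [c] compares the two trivialisations: it is
    [phi'] after the inverse of [phi]. *)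
Lemma glues_cohomologous z z' : glues cl z -> glues cl z' -> cohomologous z z'.
Proof.
move=> [[oU cU] [phi [hphi e]]] [[oU' cU'] [phi' [hphi' e']]].
exists (idx z * idx z')%type, (fun k => cov k.1 `&` cov k.2), fst, snd.
exists (fun k x w => phi' k.2 x (iso_inv (phi k.1) w)); split.
- split=> [k|x]; first exact: openI.
  by have [i ix] := cU x; have [j jx] := cU' x; exists (i, j).
- by move=> k; split=> x [].
- move=> k; apply: adapted_Aut1; first exact: openI.
    by apply: adapted_sub (hphi k.1) => y [].
  by apply: adapted_sub (hphi' k.2) => y [].
- move=> k l x [[k1 k2] [l1 l2]] v; rewrite e'; last by split.
  rewrite -[X in zval _ _ _ _ X](Kiso_inv (hphi l.1).1 v l1) e; last by split.
  by rewrite (iso_invK (hphi k.1).1).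
Qed.

(** On the intersection of [cov j] and [W l] the new trivialisation must be [psi j l]. The
    coboundary relation and the cocycle condition make it independent of [l], so these pieces fit
    together over [cov j]. *)
Lemma cohomologous_glues z z' :
  glues cl z -> cocycle z' -> cohomologous z z' -> glues cl z'.
Proof.
move=> [[oU cU] [phi [hphi e]]] [[oU' cU'] z'Q z'c].
move=> [K [W [t [t' [c [[oW cW] sW cQ ce]]]]]].
split=> //; have /choice[k hk] : forall x, exists k, W k x by [].
pose psi j l x v := zval z' j (t' l) x (c l x (phi (t l) x v)).
have psi_indep j l l' x v : cov j x -> W l x -> W l' x -> psi j l x v = psi j l' x v.
  move=> jx lx l'x; rewrite /psi -(e (t l) (t l')); last first.
    by split; apply: (sW _).1.
  rewrite -ce; last by split.
  by apply: z'c; split; [split=> //|]; exact: (sW _).2.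
exists (fun j x v => psi j (k x) x v); split=> [j|i j x [ix jx] v]; last first.
  by apply: z'c; split; [split=> //|]; exact: (sW _).2.
apply: adapted_iso_local => x jx.
exists (cov j `&` W (k x)), (psi j (k x)); split; first exact: openI.
- by split.
- apply: adapted_comp; last first.
    have [h1 h2] := z'Q j (t' (k x)).
    have sub : cov j `&` W (k x) `<=` cov j `&` cov (t' (k x)).
      by move=> y [jy ky]; split=> //; exact: (sW _).2.
    by split; [exact: (iso_sub h1) | move=> y /sub; exact: h2].
  apply: adapted_comp; last first.
    have [h1 h2] := cQ (k x).
    by split; [apply: (iso_sub h1) => y [] | move=> y [_]; exact: h2].
  by apply: adapted_sub (hphi (t (k x))) => y [_ ky]; exact: (sW _).1.
- by move=> y [jy ky] u; exact: psi_indep.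
Qed.

Lemma glues_class z : glues cl z -> cohomology_class z = glues cl.
Proof.
move=> hz; apply/funext => z'; apply/propext; split=> [[]|hz'].
  exact: cohomologous_glues.
by split; [exact: glues_cocycle | exact: glues_cohomologous].
Qed.

End Glues.

(** * Change of the identification of the retract *)

Section ActionOnSymbols.
Variable a : forall x, Egr x -> Egr x.
Hypothesis ha : @Aut0 R M O Egr deg setT a.

Let a_iso : smod_iso_on setT a := ha.1.

Lemma Aut0_proj p x (t : Egr x) : a (proj p t) = proj p (a t).
Proof.
have e q : proj p (a (proj q t)) = a (proj p (proj q t)).
  rewrite (projE _ (ha.2 q x I _ (deg_proj q t))) (projE _ (deg_proj q t)).
  by case: ifP; rewrite ?(iso0 a_iso).
have a_sum (u : 'I_m.+1 -> Egr x) : a (\sum_q u q) = \sum_q a (u q).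
  by apply: (big_morph (@a x)) => [u' v|]; [exact: (isoD a_iso) | exact: (iso0 a_iso)].
rewrite [t in LHS]proj_sumE [t in RHS]proj_sumE proj_sum !a_sum proj_sum.
by apply: eq_bigr => q _; rewrite e.
Qed.

Lemma symbol_Aut0 (E : smod O) cl : @symbol E cl ->
  symbol (fun p x (v : E x) => a (cl p x v)).
Proof.
case=> hD hZ hpar hsec hk; split.
- by move=> p x u v hu hv; rewrite hD // (isoD a_iso).
- by move=> p q x b v hb hv; rewrite -hZ // (isoZ a_iso).
- by move=> b p x v hv hb; apply: (iso_par a_iso) => //; exact: hpar.
- by move=> p x s hs hp; apply: (iso_sec a_iso) => //; exact: hsec.
move=> p x; have [h1 h2 h3] := hk p x; split=> [v hv|w hw|v hv].
- by apply: ha.2 => //; exact: h1.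
- have [v hv ev] := h2 _ (deg_proj p (iso_inv a w)).
  exists v; rewrite // ev Aut0_proj (Kiso_inv a_iso) //.
  by rewrite (projE _ hw) eqxx.
- rewrite -h3 //; split=> [e|->]; last exact: (iso0 a_iso).
  by apply: (iso_inj a_iso (x := x)); rewrite // (iso0 a_iso).
Qed.

(** The trivialisations [a] after [phi i] are adapted to the modified identification, and their
    transition maps are the conjugates of those of [z]. *)
Lemma glues_Aut0 (E : smod O) cl z : @glues E cl z ->
  glues (fun p x (v : E x) => a (cl p x v)) (@conj_cochain M (stalks Egr) a z).
Proof.
move=> [hU [phi [hphi e]]]; split=> //.
exists (fun i x v => a (phi i x v)); split=> [i|i j x ij v].
  have [h1 h2] := hphi i; split; first exact: iso_comp h1 (iso_sub a_iso _).
  move=> x ix v; rewrite -(isoB a_iso) //; apply: (iso_filtr a_iso) => //.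
  exact: h2.
rewrite /= -(e i j) //; congr (a (zval _ _ _ _ _)).
apply: (iso_inj a_iso (x := x)) => //.
by rewrite /fiber_inv; case: xgetP => [u _ //|/(_ (phi j x v)) []].
Qed.

Lemma H1_act_glues (E : smod O) cl : locally_free E -> @symbol E cl ->
  @H1_act M (stalks Egr) (@Aut1 R M O Egr) a (glues cl) =
    glues (fun p x (v : E x) => a (cl p x v)).
Proof.
move=> lfE hcl; apply/funext => z'; apply/propext; split=> [[z hz]|hz'].
  by rewrite (glues_class (glues_Aut0 hz)).
have [z hz] := glues_exists lfE hcl.
by exists z => //; rewrite (glues_class (glues_Aut0 hz)).
Qed.

End ActionOnSymbols.

Section CompareSymbols.
Variable E : smod O.

(** In degree 0 both symbol maps have kernel [filtr 1], so the value of [cl' 0] does not depend on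
    the preimage chosen under [cl 0]. *)
Lemma symbol_transfer cl cl' : @symbol E cl -> @symbol E cl' ->
  exists mu : forall x, Egr x -> Egr x,
    forall x v, mu x (cl 0%N x v) = cl' 0%N x v.
Proof.
move=> hcl hcl'.
exists (fun x w => cl' 0%N x (xget 0 [set v | cl 0%N x v = w])) => x v.
case: xgetP => [u _ /= e|/(_ v)[]//].
apply/subr0_eq; rewrite -(cl0B hcl').
have [_ _ _ _ /(_ 0%N x)[_ _ h]] := hcl.
have [_ _ _ _ /(_ 0%N x)[_ _ h']] := hcl'.
by apply/h' => //; apply/h => //; rewrite (cl0B hcl) e subrr.
Qed.

Lemma symbol_ten cl x (s : S x) : @symbol E cl -> exists v, cl 0%N x v = ten 1 s.
Proof.
case=> _ _ _ _ /(_ 0%N x)[_ h _]; have [|v _ e] := h (ten 1 s); last by exists v.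
by apply: deg_ten; rewrite -(inc1 x); exact: ext_deg_inc.
Qed.

(* [Egr = O (x) S] is generated by its component of degree 0, on which the map
   is prescribed. *)
Lemma symbol_compare_linear cl cl' : @symbol E cl -> @symbol E cl' ->
  exists a : forall x, Egr x -> Egr x,
  [/\ forall x (c : O x) u v, a x (c *: u + v) = c *: a x u + a x v,
      forall x v, a x (cl 0%N x v) = cl' 0%N x v
    & forall x (c : O x) s v, ten 1 s = cl 0%N x v ->
        a x (ten c s) = c *: cl' 0%N x v].
Proof.
move=> hcl hcl'; have [mu hmu] := symbol_transfer hcl hcl'.
have h x : exists a : Egr x -> Egr x, (forall u v, a (u + v) = a u + a v) /\
    forall c s, a (ten c s) = c *: mu x (ten 1 s).
  apply: tensor_map => [b c s|b s t|b f s].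
  - by rewrite scalerDl.
  - have [u eu] := symbol_ten s hcl; have [v ev] := symbol_ten t hcl.
    by rewrite tenDr -eu -ev -(cl0D hcl) !hmu (cl0D hcl') scalerDr.
  - have [u eu] := symbol_ten s hcl.
    have e0 : comp 0 (inc f) = inc f by rewrite (comp_deg _ (ext_deg_inc f)).
    have -> : ten 1 (f *: s) = cl 0%N x (inc f *: u).
      by rewrite -ten_inc mul1r tenE (cl0Z hcl) e0 eu.
    by rewrite -eu !hmu (cl0Z hcl') e0 scalerA.
pose a x := projT1 (cid (h x)).
have ha x : (forall u v, a x (u + v) = a x u + a x v) /\
    forall c s, a x (ten c s) = c *: mu x (ten 1 s) := projT2 (cid (h x)).
have aten x (c : O x) s v : ten 1 s = cl 0%N x v -> a x (ten c s) = c *: cl' 0%N x v.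
  by move=> e; rewrite (ha x).2 e hmu.
exists a; split=> //.
  move=> x c u v; rewrite (ha x).1; congr (_ + _).
  elim/ten_ind: u => [|b s]; last by rewrite -tenZ !(ha x).2 scalerA.
  have a0 : a x 0 = 0 by apply: (addrI (a x 0)); rewrite -(ha x).1 !addr0.
  have aB u w : a x (u - w) = a x u - a x w.
    by apply/eqP; rewrite eq_sym subr_eq -(ha x).1 subrK.
  split=> [|u w hu hw]; first by rewrite scaler0 a0 scaler0.
  by rewrite scalerBr !aB hu hw scalerBr.
move=> x v; have [_ _ _ _ /(_ 0%N x)[hdeg _ _]] := hcl.
have [s es] := deg0E (hdeg v I).
by rewrite es (aten _ _ _ v) ?scale1r // es.
Qed.

(** Linear extension in both directions gives two maps whose composites fix the generators of degree
    0, hence are identities. Parity and continuity are checked on pure tensors. *)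
Lemma symbol_compare cl cl' : @symbol E cl -> @symbol E cl' ->
  exists2 a, @Aut0 R M O Egr deg setT a & forall x v, a x (cl 0%N x v) = cl' 0%N x v.
Proof.
move=> hcl hcl'.
have [a [a_lin a_cl a_ten]] := symbol_compare_linear hcl hcl'.
have [b [b_lin b_cl b_ten]] := symbol_compare_linear hcl' hcl.
have ab_id (cl1 : nat -> forall x, E x -> Egr x) (f : forall x, Egr x -> Egr x) :
    symbol cl1 ->
    (forall x (c : O x) u v, f x (c *: u + v) = c *: f x u + f x v) ->
    (forall x v, f x (cl1 0%N x v) = cl1 0%N x v) -> forall x t, f x t = t.
  move=> h1 f_lin f_cl x t.
  have f0 : f x 0 = 0.
    by have := f_lin x (-1) 0 0; rewrite scaler0 addr0 scaleN1r addNr.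
  elim/ten_ind: t => [|c s]; last first.
    have [v ev] := symbol_ten s h1.
    by rewrite tenE -ev -[_ *: _]addr0 f_lin f_cl f0.
  split=> [//|u v hu hv].
  by rewrite -{1}[u]addr0 -{1}scaleN1r addrC addr0 f_lin hu hv scaleN1r addrC.
have aB x (u v : Egr x) : a x (u - v) = a x u - a x v.
  by rewrite addrC -scaleN1r a_lin scaleN1r addrC.
exists a => //; split; [split|].
- by move=> x _; exact: a_lin.
- move=> x _; exists (b x) => t.
    apply: (ab_id cl (fun x t => b x (a x t))) => // [y c u v|y v].
      by rewrite a_lin b_lin.
    by rewrite a_cl b_cl.
  apply: (ab_id cl' (fun x t => a x (b x t))) => // [y c u v|y v].
    by rewrite b_lin a_lin.
  by rewrite b_cl a_cl.
- move=> c x _ t; apply: ten_map_par => // {c t} c d o s ho hs.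
  have [v ev] := symbol_ten s hcl.
  have hw : mpar d (cl 0%N x v).
    have [_ ten_par _ _] := hE; rewrite ev -[d]addFb; apply: ten_par => //.
    exact: alg_par1.
  have [_ _ hpar _ hk] := hcl; have [_ _ hpar' _ _] := hcl'.
  (* The preimage [v] of a homogeneous symbol may be inhomogeneous; its component [v0] of parity [d]
     has the same symbol. *)
  have [v0 [v1 [h0 h1 e]]] := par_split (mod_super E) d v.
  have hv : cl 0%N x v = cl 0%N x v0.
    rewrite e (cl0D hcl); suff -> : cl 0%N x v1 = 0 by rewrite addr0.
    apply: (par_uniq (mod_super Egr) (b := d)); last exact: hpar.
    have -> : cl 0%N x v1 = cl 0%N x v - cl 0%N x v0.
      by rewrite e (cl0D hcl) addrC addKr.
    by apply: (parB (mod_super Egr)) => //; exact: hpar.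
  rewrite (a_ten _ _ _ v0) -?ev //; apply: mod_parZ => //.
  exact: hpar'.
- move=> x _; apply: (ten_map_sec aB) => {}x o s ho hs.
  have [v ev] := symbol_ten (s x) hcl.
  have [v' hv' v'x] := etale_through (mod_etale E) v.
  have [_ _ _ hsec _] := hcl; have [_ _ _ hsec' _] := hcl'.
  have h1 : msec x (fun y => ten 1 (s y)) by apply: ten_sec => //; exact: alg_sec1.
  have h2 : msec x (fun y => cl 0%N y (v' y)) by apply: hsec => //; exact: nearW.
  (* The section [v'] is chosen to lift [ten 1 (s x)] at [x] only; both sides being sections, the
     equality extends to a neighbourhood. *)
  have hn := etale_agree (mod_etale Egr) h1 h2 _.
  have h3 : msec x (fun y => o y *: cl' 0%N y (v' y)).
    by apply: mod_secZ => //; apply: hsec' => //; exact: nearW.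
  apply: (etale_near (mod_etale Egr) h3); apply: filterS (hn _); last by rewrite v'x ev.
  by move=> y ey; rewrite (a_ten _ _ _ _ ey).
- move=> p x _ t h; elim/sums_ind: t / h => [|t u [o [s [ho ->]]] hu].
    by have := aB x 0 0; rewrite !subrr => ->; exact: sums0.
  have aD : a x (ten o s + u) = a x (ten o s) + a x u.
    by rewrite -[ten o s in LHS]scale1r a_lin scale1r.
  rewrite aD; apply: sumsD => //.
  have [v ev] := symbol_ten s hcl; rewrite (a_ten _ _ _ v) //.
  rewrite -[p]addn0; apply: degZ => //.
  by have [_ _ _ _ /(_ 0%N x)[h _ _]] := hcl'; exact: h.
Qed.

(** Adapted isomorphisms refer to [cl] in degree 0 alone, so it is enough that [symbol_compare]
    matches two identifications there. *)
Lemma glues_eq0 (cl cl' : nat -> forall x, E x -> Egr x) :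
  (forall x v, cl 0%N x v = cl' 0%N x v) -> glues cl = glues cl'.
Proof.
suff H (cl1 cl2 : nat -> forall x, E x -> Egr x) z :
    (forall x v, cl1 0%N x v = cl2 0%N x v) -> glues cl1 z -> glues cl2 z.
  by move=> h; apply/funext => z; apply/propext; split; apply: H.
move=> h [hU [phi [hphi e]]]; split=> //; exists phi; split=> // i.
have [h1 h2] := hphi i; split=> // x ix v; rewrite -h; exact: h2.
Qed.

End CompareSymbols.

(** * Transport of identifications along isomorphisms of sheaves *)

Section Transport.
Variables (E E' : smod O) (psi : forall x, E x -> E' x).
Hypothesis hpsi : smod_iso_on setT psi.

Lemma symbol_transport cl : @symbol E' cl -> symbol (fun p x (v : E x) => cl p x (psi v)).
Proof.
have psi_filtr p x (v : E x) : filtr p v -> filtr p (psi v).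
  exact: (iso_filtr hpsi).
case=> hD hZ hpar hsec hk; split.
- by move=> p x u v hu hv; rewrite (isoD hpsi) // hD //; exact: psi_filtr.
- by move=> p q x b v hb hv; rewrite (isoZ hpsi) //; apply: hZ => //; exact: psi_filtr.
- move=> b p x v hv hb; apply: hpar; first exact: psi_filtr.
  exact: (iso_par hpsi).
- move=> p x s hs hp; apply: hsec; first exact: (iso_sec hpsi).
  by apply: filterS hp => y; exact: psi_filtr.
move=> p x; have [h1 h2 h3] := hk p x; split=> [v hv|w /h2[v hv <-]|v hv].
- exact/h1/psi_filtr.
- exists (iso_inv psi v); last by rewrite (Kiso_inv hpsi).
  by apply: (iso_filtr_reflect hpsi) => //; rewrite (Kiso_inv hpsi).
- rewrite h3; last exact: psi_filtr.
  by split; [exact: (iso_filtr_reflect hpsi) | exact: psi_filtr].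
Qed.

(** Both sides are cohomology classes, so one common cocycle [z] gives the equality. *)
Lemma glues_transport cl : locally_free E' -> @symbol E' cl ->
  glues cl = glues (fun p x (v : E x) => cl p x (psi v)).
Proof.
move=> lfE' hcl; have [z hz] := glues_exists lfE' hcl.
rewrite -(glues_class hz); apply: glues_class.
case: hz => hU [phi [hphi e]]; split=> //.
exists (fun i x v => phi i x (psi v)); split=> [i|i j x ij v]; last exact: e.
have [h1 h2] := hphi i; split; first exact: iso_comp (iso_sub hpsi _) h1.
by move=> x ix v; exact: h2.
Qed.

End Transport.

(** The inverse of [phi' i] after [phi i] does not depend on [i] on overlaps, because both families
    have the transition maps [z]. *)
Lemma glues_iso (E E' : smod O) cl cl' z : @glues E cl z -> @glues E' cl' z ->
  exists psi, @smod_iso_on R M O setT E E' psi.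
Proof.
move=> [[oU cU] [phi [hphi e]]] [_ [phi' [hphi' e']]].
have /choice[k hk] := cU.
exists (fun x v => iso_inv (phi' (k x)) (phi (k x) x v)).
apply: iso_local => x _.
exists (cov (k x)), (fun y v => iso_inv (phi' (k x)) (phi (k x) y v)); split=> //.
  apply: iso_comp (hphi _).1 _; exact: iso_inv_iso (hphi' _).1 _.
move=> y ky u; apply: (iso_inj (hphi' (k x)).1 ky).
rewrite (Kiso_inv (hphi' (k x)).1) //.
have kk : (cov (k x) `&` cov (k y)) y by split.
by rewrite -(e' _ _ _ kk) (Kiso_inv (hphi' (k y)).1) // e.
Qed.

(** * Gluing along a cocycle *)

Lemma tensor_locally_free : locally_free S -> locally_free Egr.
Proof.
move=> lfS x; have [p [q [U [chi [oU Ux hchi]]]]] := lfS x.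
have hinv := iso_inv_iso hchi oU; have [_ ten_par _ _] := hE.
pose e j y := ten 1 (chi y (basis_vec F j y)).
pose phi y (v : free_smod O p q y) := \sum_j (v : 'rV[O y]_(p + q)) ord0 j *: e j y.
have phi_lin y (a : O y) u v : phi y (a *: u + v) = a *: phi y u + phi y v.
  rewrite scaler_sumr -big_split; apply: eq_bigr => j _ /=.
  by rewrite !mxE scalerDl scalerA.
exists p, q, U, phi; split=> //; split=> [y _|y Uy|b y Uy v hv|y Uy s hs].
- exact: phi_lin.
(* The inverse comes from the universal property: a pure tensor goes to [a] times the coordinates of
   [s] in the local basis of [S], carried to [O] by [inc]. *)
- pose r (s : S y) : 'rV[F y]_(p + q) := iso_inv chi s.
  have [|||g [gD g_ten]] := @tensor_map y 'rV[O y]_(p + q)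
    (fun a s => \row_j (a * inc (r s ord0 j))).
  + by move=> a b s; apply/rowP => j; rewrite !mxE mulrDl.
  + move=> a s t; apply/rowP => j; rewrite !mxE -mulrDr -incD /r.
    by have := iso_lin hinv Uy 1 s t; rewrite !scale1r => ->; rewrite mxE.
  + move=> a f s; apply/rowP => j; rewrite !mxE -mulrA -incM /r.
    by rewrite (isoZ hinv) // mxE.
  have g0 : g 0 = 0 by apply: (addrI (g 0)); rewrite -gD !addr0.
  have gB u v : g (u - v) = g u - g v.
    by apply/eqP; rewrite eq_sym subr_eq -gD subrK.
  exists g.
    move=> v; rewrite (big_morph g gD g0); apply/rowP => i.
    rewrite summxE (bigD1 i) //= big1 => [|j ji].
      rewrite -tenE g_ten mxE /r (iso_invK hchi) // mxE !eqxx inc1 mulr1 addr0 //.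
    by rewrite -tenE g_ten mxE /r (iso_invK hchi) // mxE eq_sym (negPf ji) andbF inc0 mulr0.
  move=> t; elim/ten_ind: t => [|a s].
    have phi0 : phi y 0 = 0 by apply: big1 => j _; rewrite mxE scale0r.
    split=> [|u v hu hv]; first by rewrite g0.
    rewrite gB -[LHS]/(phi y (g u - g v)) addrC -scaleN1r phi_lin scaleN1r.
    by rewrite hu hv addrC.
  rewrite g_ten /phi -[in RHS](Kiso_inv hchi s Uy) (free_iso_sum hchi) //.
  have ten0r : ten a 0 = 0 by apply: (addrI (ten a 0)); rewrite -tenDr !addr0.
  rewrite (big_morph (ten a) (@tenDr y a) ten0r); apply: eq_bigr => j _.
  by rewrite mxE -ten_inc [RHS]tenE.
- apply: (par_sum (mod_super Egr)) => j _.
  have he : mpar (p <= j)%N (e j y).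
    rewrite -[(p <= j)%N]addFb; apply: ten_par; first exact: alg_par1.
    exact/(iso_par hchi Uy)/basis_vec_par.
  by have := mod_parZ (hv j) he; rewrite addbK.
- apply: (sec_sum (mod_etale Egr) (@mod_secB _ _ _ Egr)) => j _.
  apply: mod_secZ; first exact: hs.
  apply: ten_sec; first exact: alg_sec1.
  exact/(iso_sec hchi Uy)/basis_vec_sec.
Qed.

(** The condition modulo step 1 propagates by linearity, since each factor from the odd ideal can be
    pulled out. Thus sections of [Aut1] fix symbols of all degrees. *)
Lemma Aut1_filtr U (a : forall x, Egr x -> Egr x) : @Aut1 R M O Egr U a ->
  forall x, U x -> forall p t, filtr p t -> filtr p.+1 (a x t - t).
Proof.
move=> [ha a1] x Ux; elim=> [|p IH] t h; first exact: a1.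
elim/sums_ind: t / h => [|t u [j [v [hj hv ->]]] hu].
  by rewrite (iso0 ha) // subrr; exact: filtr0.
rewrite (isoD ha) // opprD addrACA; apply: filtrD => //.
by rewrite (isoZ ha) // -scalerBr; apply: filtr_odd => //; exact: IH.
Qed.

Section Gluing.
Variables (z : cochain) (hz : cocycle z) (k : M -> idx z).
Hypothesis kP : forall x, cov (k x) x.

Let z_iso i j : smod_iso_on (cov i `&` cov j) (@Defs.val _ _ z i j).
Proof. by case: hz => _ h _; case: (h i j). Qed.

Let z_comp i j l x v : cov i x -> cov j x -> cov l x ->
  zval z i j x (zval z j l x v) = zval z i l x v.
Proof. by move=> ix jx lx; case: hz => _ _; apply. Qed.

(** The transition map from a chart to itself is idempotent by the cocycle condition, and it is
    injective. *)
Let z_id i x v : cov i x -> zval z i i x v = v.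
Proof.
by move=> ix; apply: (iso_inj (z_iso i i) (x := x)) => //; exact: z_comp.
Qed.

Let cov_nbhs (i : idx z) x : cov i x -> nbhs x (cov i).
Proof. by case: hz => -[oU _] _ _ ix; exact: open_nbhs_nbhs. Qed.

(* The stalk at [x] is the stalk of the sheaf over [cov (k x)]. *)
Definition glue_sec (x : M) (s : forall y, Egr y) :=
  msec x (fun y => zval z (k x) (k y) y (s y)).

Lemma glue_sec_change (i j : idx z) x (s : forall y, Egr y) : cov i x -> cov j x ->
  msec x (fun y => zval z i (k y) y (s y)) ->
  msec x (fun y => zval z j (k y) y (s y)).
Proof.
move=> ix jx hs.
apply: (etale_near (mod_etale Egr) (iso_sec (z_iso j i) (conj jx ix) hs)).
by apply: filterS2 (cov_nbhs ix) (cov_nbhs jx) => y iy jy; exact: z_comp.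
Qed.

Lemma glue_secP (i : idx z) x s : cov i x ->
  glue_sec x s <-> msec x (fun y => zval z i (k y) y (s y)).
Proof. by move=> ix; split; exact: glue_sec_change. Qed.

Lemma glue_etale : @etale M (mod Egr) glue_sec.
Proof.
have eE := mod_etale Egr; split.
- move=> x s t hs hst; apply: (etale_near eE hs).
  by apply: filterS hst => y ->.
- move=> x s hs; apply: filterS2 (etale_open eE hs) (cov_nbhs (kP x)) => y hy ky.
  by apply/(glue_secP s ky).
- move=> x v; have [t ht tx] := etale_through eE v.
  exists (fun y => zval z (k y) (k x) y (t y)); last by rewrite z_id.
  apply: (etale_near eE ht); apply: filterS (cov_nbhs (kP x)) => y ky.
  by rewrite z_comp // z_id.
- move=> x s t hs ht e.
  have e' : zval z (k x) (k x) x (s x) = zval z (k x) (k x) x (t x) by rewrite e.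
  apply: filterS2 (etale_agree eE hs ht e') (cov_nbhs (kP x)) => y ey ky.
  exact: (iso_inj (z_iso (k x) (k y)) (x := y)).
Qed.

Lemma glue_super : @superspace M (mod Egr) glue_sec (@mpar _ _ _ Egr).
Proof.
have [s1 s2 s3 s4] := mod_super Egr; split=> // b x s hs hb.
have hb' : mpar b (zval z (k x) (k x) x (s x)) by rewrite z_id.
apply: filterS2 (s4 b x _ hs hb') (cov_nbhs (kP x)) => y hy ky.
exact: (iso_par_reflect (z_iso (k x) (k y)) (x := y)).
Qed.

Lemma glue_secB x s t : glue_sec x s -> glue_sec x t -> glue_sec x (fun y => s y - t y).
Proof.
move=> hs ht; apply: (etale_near (mod_etale Egr) (mod_secB hs ht)).
by apply: filterS (cov_nbhs (kP x)) => y ky; rewrite (isoB (z_iso (k x) (k y))).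
Qed.

Lemma glue_secZ x (a : forall y, O y) s :
  asec x a -> glue_sec x s -> glue_sec x (fun y => a y *: s y).
Proof.
move=> ha hs; apply: (etale_near (mod_etale Egr) (mod_secZ ha hs)).
by apply: filterS (cov_nbhs (kP x)) => y ky; rewrite (isoZ (z_iso (k x) (k y))).
Qed.

(** Stalks, module structure and parity are those of [Egr]; the cocycle enters through the sections
    alone. Hence the filtration and the projections of [Egr] apply stalk by stalk. *)
Definition glued : smod O :=
  @SMod R M O (mod Egr) glue_sec (@mpar _ _ _ Egr) glue_etale glue_super
    glue_secB glue_secZ (@mod_parZ _ _ _ Egr).

Let phi (i : idx z) y (v : glued y) : Egr y := zval z i (k y) y v.

Lemma glued_iso i : smod_iso_on (cov i) (phi i).
Proof.
split=> [x ix a u v|x ix|b x ix u|x ix s hs].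
- exact: (iso_lin (z_iso i (k x))).
- exact: (iso_bij (z_iso i (k x))).
- exact: (iso_par (z_iso i (k x))).
- exact/(glue_secP s ix).
Qed.

Lemma glued_locally_free : locally_free Egr -> locally_free glued.
Proof.
move=> lf x; have [p [q [U [chi [oU Ux hchi]]]]] := lf x.
have [[oW _] _ _] := hz.
exists p, q, (U `&` cov (k x)), (fun y v => iso_inv (phi (k x)) (chi y v)).
split; [exact: openI | by split |].
have hinv := iso_inv_iso (glued_iso (k x)) (oW _).
apply: (iso_comp (iso_sub hchi _) (iso_sub hinv _)) => y [] //.
Qed.

Lemma filtr_glued p x (v : Egr x) :
  @filtr _ _ _ glued p x v <-> @filtr _ _ _ Egr p x v.
Proof.
elim: p v => [//|p IH] v; split; apply: sumsS => w [j [u [hj hu ->]]];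
  by apply: sums1; exists j, u; split=> //; apply/IH.
Qed.

Lemma proj_ext_degZ p q x (a : O x) (t : Egr x) : odeg q a ->
  a *: proj p t = proj (p + q) (a *: t).
Proof.
move=> ha; rewrite [t in LHS]proj_sumE [t in RHS]proj_sumE.
rewrite scaler_sumr !proj_sum scaler_sumr; apply: eq_bigr => r _.
rewrite (projE _ (deg_proj r t)) (projE _ (degZ ha (deg_proj r t))).
by rewrite addnC eqn_add2l; case: ifP; rewrite // scaler0.
Qed.

Lemma glued_symbol : symbol (fun p x (v : glued x) => proj p (v : Egr x)).
Proof.
split.
- by move=> p x u v _ _; exact: projD.
- by move=> p q x a v ha _; exact: proj_ext_degZ.
- by move=> b p x v _; exact: proj_par.
- move=> p x s hs hp.
  (* Near [x] the family [s] is a section after twisting by [z (k x) (k y)], and the twist leaves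
     the component of degree [p] of an element of [filtr p] unchanged. *)
  apply: (etale_near (mod_etale Egr) (proj_sec p hs)).
  apply: filterS2 hp (cov_nbhs (kP x)) => y /filtr_glued hy ky.
  have [_ /(_ (k x) (k y)) h1 _] := hz.
  have /filtrE/(_ p (ltnSn p)) := Aut1_filtr h1 (conj ky (kP y)) hy.
  by rewrite projB => /subr0_eq.
move=> p x; split=> [v _|w hw|v /filtr_glued hv]; first exact: deg_proj.
- exists w; last by rewrite (projE _ hw) eqxx.
  by apply/filtr_glued; exact: filtr_deg hw.
- rewrite filtr_glued filtrE; split=> [h q|h]; last exact: h.
  rewrite ltnS leq_eqVlt => /orP[/eqP->//|hq].
  by move/filtrE: hv; exact.
Qed.

Lemma glued_glues : glues (fun p x (v : glued x) => proj p (v : Egr x)) z.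
Proof.
have [hU hQ _] := hz; split=> //; exists phi; split=> [i|i j x [ix jx] v]; last first.
  exact: z_comp.
split=> [|x ix v]; first exact: glued_iso.
have := Aut1_filtr (hQ i (k x)) (conj ix (kP x)) (p := 0) I.
move=> /(_ v) h; rewrite -(subrK (v : Egr x) (phi i v)) -addrA; apply: filtrD => //.
apply/filtrE => -[|//] _.
by rewrite projB (projE _ (deg_proj 0 v)) eqxx subrr.
Qed.

End Gluing.

Lemma cocycle_glues z : locally_free S -> cocycle z ->
  exists (E : smod O) cl, [/\ locally_free E, symbol cl & @glues E cl z].
Proof.
move=> lfS hz; have [[_ /choice[k hk]] _ _] := hz.
exists (glued hz hk), (fun p x v => proj p (v : Egr x)); split.
- exact/glued_locally_free/tensor_locally_free.
- exact: glued_symbol.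
- exact: glued_glues.
Qed.

(** * The bijection between isomorphism classes and orbits *)

Lemma iso_class_eq (E E' : smod O) :
  (exists psi, @smod_iso_on R M O setT E E' psi) -> iso_class E = iso_class E'.
Proof.
move=> [psi hpsi]; have hinv := iso_inv_iso hpsi openT.
apply/funext => E''; apply/propext; split=> -[chi hchi].
  by exists (fun x v => chi x (iso_inv psi v)); exact: iso_comp hinv hchi.
by exists (fun x v => chi x (psi x v)); exact: iso_comp hpsi hchi.
Qed.

Definition gluing_classes (C : large (smod O)) : large (large cochain) :=
  fun c => exists E cl, [/\ C E, locally_free E, @symbol E cl & c = glues cl].

(** An identification for an isomorphic sheaf is pulled back to [E], where it differs from [cl] in
    degree 0 by a section of [Aut0]; conversely every such section turns [cl] into another
    identification. *)
Lemma gluing_classes_orbit (E : smod O) cl : locally_free E -> @symbol E cl ->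
  gluing_classes (iso_class E) = fun c => exists2 a,
    @Aut0 R M O Egr deg setT a &
    c = @H1_act M (stalks Egr) (@Aut1 R M O Egr) a (glues cl).
Proof.
move=> lfE hcl; apply/funext => c; apply/propext; split; last first.
  move=> [a ha ->]; exists E, (fun p x v => a x (cl p x v)); split=> //.
  - by exists (fun=> id); exact: iso_id.
  - exact: symbol_Aut0.
  - exact: H1_act_glues.
move=> [E' [cl' [[psi hpsi] lfE' hcl' ->]]].
have [a ha ea] := symbol_compare hcl (symbol_transport hpsi hcl').
exists a; rewrite // (H1_act_glues ha lfE hcl) (glues_transport hpsi lfE' hcl').
by apply: glues_eq0 => x v; rewrite ea.
Qed.

(** Equal orbits share a cohomology class, hence a cocycle [z] from which [E] and a sheaf isomorphic
    to [E'] are both glued. *)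
Lemma gluing_classes_inj (E E' : smod O) cl : locally_free E -> @symbol E cl ->
  gluing_classes (iso_class E) = gluing_classes (iso_class E') ->
  iso_class E = iso_class E'.
Proof.
move=> lfE hcl e.
have : gluing_classes (iso_class E) (glues cl).
  by exists E, cl; split=> //; exists (fun=> id); exact: iso_id.
rewrite e => -[E'' [cl'' [E'E'' _ _ e'']]].
have [z hz] := glues_exists lfE hcl.
have hz'' : glues cl'' z by rewrite -e''.
by rewrite (iso_class_eq (glues_iso hz hz'')) (iso_class_eq E'E'').
Qed.

Lemma gluing_classes_surj o : locally_free S ->
  @H1_orbits M (stalks Egr) (@Aut1 R M O Egr) (@Aut0 R M O Egr deg) o ->
  exists E : smod O, [/\ locally_free E, retract_is odeg E deg &
    gluing_classes (iso_class E) = o].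
Proof.
move=> lfS [c [z hz ->] ->].
have [E [cl [lfE hcl hglue]]] := cocycle_glues lfS hz.
exists E; split=> //; first by apply/retractP; exists cl.
by rewrite (gluing_classes_orbit lfE hcl) (glues_class hglue).
Qed.

Lemma gluing_classes_H1 (E : smod O) : locally_free E -> retract_is odeg E deg ->
  @H1_orbits M (stalks Egr) (@Aut1 R M O Egr) (@Aut0 R M O Egr deg)
    (gluing_classes (iso_class E)).
Proof.
move=> lfE /retractP[cl hcl]; have [z hz] := glues_exists lfE hcl.
exists (glues cl); last exact: gluing_classes_orbit.
by exists z; [exact: glues_cocycle hz | rewrite (glues_class hz)].
Qed.

(** Conjugation fixes the trivial cochain itself, as [fiber_inv a] is a right inverse of [a]. A
    sheaf glued from that cochain lets [H1_act_glues] turn this into an equality of classes. *)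
Lemma H1_unit_fixed a : locally_free S -> @Aut0 R M O Egr deg setT a ->
  @H1_act M (stalks Egr) (@Aut1 R M O Egr) a
    (@H1_unit M (stalks Egr) (@Aut1 R M O Egr)) =
  @H1_unit M (stalks Egr) (@Aut1 R M O Egr).
Proof.
move=> lfS ha; set t := trivial_cochain (stalks Egr).
have ht : cocycle t.
  split=> [|i j|//]; first by split=> [i|x]; [exact: openT | exists tt].
  split=> [|x _ v]; first exact: iso_id.
  by rewrite /t /= subrr; exact: sums0.
have [E [cl [lfE hcl hglue]]] := cocycle_glues lfS ht.
have conj_t : @conj_cochain M (stalks Egr) a t = t.
  congr Cochain; do 2!apply/funext => ?.
  apply: functional_extensionality_dep => x; apply/funext => v.
  rewrite /fiber_inv; case: xgetP => [u _ //|/(_ (iso_inv a v)) []].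
  exact: (Kiso_inv ha.1).
rewrite /H1_unit -/t {1}(glues_class hglue) (H1_act_glues ha lfE hcl).
by rewrite -(glues_class (glues_Aut0 ha hglue)) conj_t.
Qed.

End Retract.

Theorem theorem3 (R : realType) (M : topologicalType) (n m : nat)
  (O : salg R M) (hO : supermanifold n m O)
  (F : salg R M) (pr : forall x : M, O x -> F x) (hF : reduction pr)
  (G : smod F) (hG : locally_free G)
  (inc : forall x : M, F x -> O x) (io : forall x : M, G x -> O x)
  (hsplit : exterior_algebra inc io)
  (hinc : forall (x : M) (f : F x), pr x (inc x f) = f)
  (S : smod F) (hS : locally_free S)
  (Egr : smod O) (ten : forall x : M, O x -> S x -> Egr x)
  (hE : tensor_product inc ten) :
  (exists Phi : large (smod O) -> large (large (cochain (stalks Egr))),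
     large_bij
       (fun c => exists E : smod O,
          [/\ locally_free E,
              retract_is (ext_deg inc io) E (ten_deg inc io ten)
            & c = iso_class E])
       (@H1_orbits M (stalks Egr) (@Aut1 R M O Egr)
          (@Aut0 R M O Egr (ten_deg inc io ten)))
       Phi) /\
  (forall a : forall x : M, Egr x -> Egr x,
     Aut0 (ten_deg inc io ten) setT a ->
     @H1_act M (stalks Egr) (@Aut1 R M O Egr) a
       (@H1_unit M (stalks Egr) (@Aut1 R M O Egr)) =
     @H1_unit M (stalks Egr) (@Aut1 R M O Egr)).
Proof.
split; last by move=> a; exact: (H1_unit_fixed hO hF hsplit hinc hE hS).
exists (gluing_classes inc io ten); split.
- move=> _ [E [lfE hretr ->]].
  exact: (gluing_classes_H1 hO hF hsplit hinc hE).
- move=> _ _ [E [lfE hretr ->]] [E' [_ _ ->]].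
  have [cl hcl] := (retractP hsplit ten E).1 hretr.
  exact: (gluing_classes_inj hO hF hsplit hinc hE lfE hcl).
- move=> o /(gluing_classes_surj hO hF hsplit hinc hE hS)[E [lfE hretr <-]].
  by exists (iso_class E) => //; exists E.
Qed.
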